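(* Let $(R,\mathfrak m)$ be a $d$-dimensional complete noetherian local Cohen-Macaulay integral domain. Then the local cohomology module $H^d_{\mathfrak m}(R)$ has no nontrivial highly divisible submodule; that is, the only submodules of $H^d_{\mathfrak m}(R)$ that can be highly divisible are $0$ and $H^d_{\mathfrak m}(R)$.
   Context: Let $(R,\mathfrak m)$ be local of dimension $d$. An $R$-module $E$ is highly divisible if for every system of parameters $x_1,\dots,x_d$ of $R$ and every $0\le i<d$ the multiplication map $\operatorname{Ann}_E(x_1,\dots,x_i)\xrightarrow{\,x_{i+1}\,}\operatorname{Ann}_E(x_1,\dots,x_i)$ is surjective, where $\operatorname{Ann}_E(x_1,\dots,x_i)=\{e\in E: x_1e=\dots=x_ie=0\}$ (equal to $E$ when $i=0$). *)

(* Defs.v *)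
From HB Require Import structures.
From mathcomp Require Import all_boot all_order all_algebra.
From mathcomp Require Import generic_quotient ring_quotient.
From mathcomp Require Import boolp.

Set Implicit Arguments.
Unset Strict Implicit.
Unset Printing Implicit Defensive.

Import GRing.Theory.
Local Open Scope ring_scope.
Local Open Scope quotient_scope.

(* Subsets are boolean predicates {pred _}; arbitrary propositions become      *)
(* booleans through classical reasoning (`[< _ >] from boolp).  Ideals, not    *)
(* necessarily proper, are submodules of R^o (submodClosed R^o); idealr R and  *)
(* prime_idealr R are the proper and the prime ideals.                         *)

(** * Noetherian complete local rings *)

Section Rings.
Variable R : comNzRingType.
Implicit Types (J : {pred R}) (m : idealr R) (s : seq R).

(* The ideal (s_0, ..., s_(n-1)); it is 0 for the empty sequence. *)
Definition ideal_gen s : {pred R} :=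
  [pred a | `[< exists c : nat -> R, a = \sum_(i < size s) c i * s`_i >]].

(* J ^ k, the ideal generated by the products of k elements of J; J ^ 0 = R. *)
Definition ideal_exp J (k : nat) : {pred R} :=
  [pred a | `[< exists (n : nat) (c : 'I_n -> R) (t : 'I_n -> k.-tuple R),
      (forall i, {subset t i <= J}) /\
      a = \sum_(i < n) c i * \prod_(x <- t i) x >]].

Definition radical J : {pred R} := [pred a | `[< exists k : nat, a ^+ k \in J >]].

Definition noetherian : Prop :=
  forall J : submodClosed R^o, exists s : seq R, J =i ideal_gen s.

Definition maximal_ideal m : Prop :=
  forall J : idealr R, {subset m <= J} -> J =i m.

Definition local_ring m : Prop :=
  maximal_ideal m /\ forall m' : idealr R, maximal_ideal m' -> m' =i m.

(* P 0, ..., P n is a strictly increasing chain of prime ideals, of length n. *)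
Definition prime_chain n (P : 'I_n.+1 -> prime_idealr R) : Prop :=
  forall i j : 'I_n.+1, (i < j)%N ->
    {subset P i <= P j} /\ exists2 x, x \in P j & x \notin P i.

Definition krull_dim (n : nat) : Prop :=
  (exists P : 'I_n.+1 -> prime_idealr R, prime_chain P) /\
  (forall k (P : 'I_k.+1 -> prime_idealr R), prime_chain P -> (k <= n)%N).

(* The canonical map from R to the inverse limit of the R / J ^ k is           *)
(* injective and surjective.                                                   *)
Definition adically_complete J : Prop :=
  (forall a, (forall k, a \in ideal_exp J k) -> a = 0) /\
  (forall u : nat -> R, (forall k, u k.+1 - u k \in ideal_exp J k) ->
     exists a, forall k, a - u k \in ideal_exp J k).

Definition regular_sequence s : Prop :=
  (forall i a, (i < size s)%N ->
     s`_i * a \in ideal_gen (take i s) -> a \in ideal_gen (take i s)) /\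
  1 \notin ideal_gen s.

Definition depth m (n : nat) : Prop :=
  (exists s, [/\ size s = n, {subset s <= m} & regular_sequence s]) /\
  (forall s, {subset s <= m} -> regular_sequence s -> (size s <= n)%N).

Definition cohen_macaulay m : Prop := exists2 n, krull_dim n & depth m n.

(* dim R elements generating an m-primary ideal, for m maximal. *)
Definition system_of_parameters m d (x : d.-tuple R) : Prop :=
  krull_dim d /\ radical (ideal_gen x) =i m.

End Rings.

Arguments noetherian : clear implicits.
Arguments krull_dim : clear implicits.

Section HighlyDivisible.
Variables (R : comNzRingType) (m : idealr R) (d : nat) (E : lmodType R).

(* The annihilator in E of x_1, ..., x_i. *)
Definition ann_prefix (x : d.-tuple R) (i : nat) : {pred E} :=
  [pred e | [forall j : 'I_d, (j < i)%N ==> (tnth x j *: e == 0)]].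

Definition highly_divisible : Prop :=
  forall x : d.-tuple R, system_of_parameters m x ->
  forall i : 'I_d, forall e, e \in ann_prefix x i ->
    exists2 e', e' \in ann_prefix x i & tnth x i *: e' = e.

End HighlyDivisible.

(** * Submodules and quotient modules *)

Section Submodule.
Variables (R : comNzRingType) (V : lmodType R) (S : submodClosed V).

Record submodule := Submodule {
  submodule_val :> V;
  submodule_valP : submodule_val \in S }.

HB.instance Definition _ := [isSub for submodule_val].
HB.instance Definition _ := [Choice of submodule by <:].
HB.instance Definition _ := [SubChoice_isSubLmodule of submodule by <:].

End Submodule.

Section QuotientModule.
Variables (R : comNzRingType) (V : lmodType R) (S : submodClosed V).

Definition submod_pred (v : V) : bool := v \in S.

Fact submod_pred_zmod_closed : zmod_closed submod_pred.
Proof. exact: GRing.submod_closedB (GRing.submodClosedP S). Qed.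

HB.instance Definition _ :=
  GRing.isZmodClosed.Build V submod_pred submod_pred_zmod_closed.

Definition submod_zmod : zmodClosed V := GRing.ZmodClosed.clone V submod_pred _.

Definition quotient_module := Quotient.quot submod_zmod.

HB.instance Definition _ := GRing.Zmodule.on quotient_module.

Local Notation Q := quotient_module.
Local Notation pi := (\pi_(Quotient.quot submod_zmod)).

Definition quotient_scale (a : R) (q : Q) : Q := pi (a *: repr q).

Fact quotient_scaleE a v : quotient_scale a (pi v) = pi (a *: v).
Proof.
apply/eqP; rewrite /quotient_scale -Quotient.idealrBE -scalerBr.
suff vS : repr (pi v) - v \in submod_zmod by exact: (rpredZ a vS : _ \in S).
by rewrite Quotient.idealrBE reprK.
Qed.

Let scaleA a b (q : Q) :
  quotient_scale a (quotient_scale b q) = quotient_scale (a * b) q.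
Proof.
elim/quotW: q => v.
by rewrite (quotient_scaleE b v) (quotient_scaleE a) (quotient_scaleE _ v) scalerA.
Qed.

Let scale1 : left_id 1 quotient_scale.
Proof. by elim/quotW => v; rewrite (quotient_scaleE 1 v) scale1r. Qed.

Let scaleDr : right_distributive quotient_scale +%R.
Proof.
move=> a; elim/quotW => u; elim/quotW => v.
rewrite -raddfD (quotient_scaleE a (u + v)) (quotient_scaleE a u).
by rewrite (quotient_scaleE a v) scalerDr raddfD.
Qed.

Let scaleDl (q : Q) : {morph quotient_scale^~ q : a b / a + b}.
Proof.
elim/quotW: q => v a b.
rewrite (quotient_scaleE _ v) (quotient_scaleE a v) (quotient_scaleE b v).
by rewrite scalerDl raddfD.
Qed.

HB.instance Definition _ :=
  GRing.Zmodule_isLmodule.Build R Q scaleA scale1 scaleDr scaleDl.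

End QuotientModule.

(** * Cohomology of cochain complexes *)

Section Kernel.
Variables (R : comNzRingType) (V W : lmodType R) (f : {linear V -> W}).

Definition kernel_pred (v : V) : bool := f v == 0.

Fact kernel_closed : GRing.subsemimod_closed kernel_pred.
Proof.
have kerE v : (v \in kernel_pred) = (f v == 0) by [].
split; first split; rewrite ?kerE ?raddf0 //.
- by move=> u v; rewrite !kerE linearD => /eqP fu /eqP fv; rewrite fu fv addr0.
- by move=> a v; rewrite !kerE linearZ => /eqP fv; rewrite /= fv scaler0.
Qed.

HB.instance Definition _ := GRing.isSubmodClosed.Build R V kernel_pred kernel_closed.

Definition kernel : submodClosed V := GRing.SubmodClosed.clone R V kernel_pred _.

End Kernel.

Section Cohomology.
Variable R : comNzRingType.

Record cochain_complex := CochainComplex {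
  cc_obj :> nat -> lmodType R;
  cc_diff : forall n, {linear cc_obj n -> cc_obj n.+1};
  cc_diffK : forall n x, cc_diff n.+1 (cc_diff n x) = 0 }.

Variables (C : cochain_complex) (n : nat).

Definition cocycles : lmodType R := submodule (kernel (cc_diff C n)).

(* C is extended by 0 in negative degrees, so only 0 bounds in degree 0. *)
Definition is_coboundary : C n -> Prop :=
  match n return C n -> Prop with
  | 0 => fun x => x = 0
  | k.+1 => fun x => exists y : C k, cc_diff C k y = x
  end.

Definition coboundaries_pred (z : cocycles) : bool :=
  `[< is_coboundary (submodule_val z) >].

Fact is_coboundary_closed :
  [/\ is_coboundary 0,
      forall x y, is_coboundary x -> is_coboundary y -> is_coboundary (x + y)
    & forall a x, is_coboundary x -> is_coboundary (a *: x)].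
Proof.
rewrite /is_coboundary; case: n => [|k] /=; split=> //.
- by move=> x y -> ->; rewrite addr0.
- by move=> a x ->; rewrite scaler0.
- by exists 0; rewrite linear0.
- by move=> x y [x' <-] [y' <-]; exists (x' + y'); rewrite linearD.
- by move=> a x [x' <-]; exists (a *: x'); rewrite linearZ.
Qed.

Fact coboundaries_closed : GRing.subsemimod_closed coboundaries_pred.
Proof.
have [B0 BD BZ] := is_coboundary_closed.
split; first split.
- exact/asboolP.
- by move=> x y /asboolP Bx /asboolP By; apply/asboolP; apply: BD.
- by move=> a x /asboolP Bx; apply/asboolP; apply: BZ.
Qed.

HB.instance Definition _ :=
  GRing.isSubmodClosed.Build R cocycles coboundaries_pred coboundaries_closed.

Definition coboundaries : submodClosed cocycles :=
  GRing.SubmodClosed.clone R cocycles coboundaries_pred _.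

Definition cohomology : lmodType R := quotient_module coboundaries.

End Cohomology.

(** * Local cohomology *)

(* The functor Gamma_J, sending M to {x in M | J ^ k x = 0 for some k}. *)
Section Torsion.
Variables (R : comNzRingType) (J : {pred R}).

Section Object.
Variable M : lmodType R.

Definition torsion_pred (x : M) : bool :=
  `[< exists k : nat, forall a, a \in ideal_exp J k -> a *: x = 0 >].

Lemma ideal_exp_add k l a :
  a \in ideal_exp J (k + l) -> a \in ideal_exp J k /\ a \in ideal_exp J l.
Proof.
case/asboolP=> p [c [t [tJ ->]]]; split; apply/asboolP.
- exists p, (fun i => c i * \prod_(x <- drop k (t i)) x).
  have sz i : size (take k (t i)) == k by rewrite size_takel // size_tuple leq_addr.
  exists (fun i => Tuple (sz i)); split=> [i x /mem_take /tJ //|].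
  apply: eq_bigr => i _; rewrite /= -mulrA [X in _ = _ * X]mulrC -big_cat.
  by rewrite cat_take_drop.
- exists p, (fun i => c i * \prod_(x <- take k (t i)) x).
  have sz i : size (drop k (t i)) == l by rewrite size_drop size_tuple addKn.
  exists (fun i => Tuple (sz i)); split=> [i x /mem_drop /tJ //|].
  by apply: eq_bigr => i _; rewrite /= -mulrA -big_cat cat_take_drop.
Qed.

Fact torsion_closed : GRing.subsemimod_closed torsion_pred.
Proof.
split; first split.
- by apply/asboolP; exists 0 => a _; rewrite scaler0.
- move=> x y /asboolP[k xk] /asboolP[l yl]; apply/asboolP.
  exists (k + l)%N => a /ideal_exp_add[ak al].
  by rewrite scalerDr xk // yl // addr0.
- move=> b x /asboolP[k xk]; apply/asboolP; exists k => a ak.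
  by rewrite scalerA mulrC -scalerA xk // scaler0.
Qed.

HB.instance Definition _ := GRing.isSubmodClosed.Build R M torsion_pred torsion_closed.

Definition torsion : submodClosed M := GRing.SubmodClosed.clone R M torsion_pred _.

Definition Gamma : lmodType R := submodule torsion.

End Object.

Section Morphism.
Variables (M N : lmodType R) (f : {linear M -> N}).

Fact torsion_map (x : Gamma M) : f (submodule_val x) \in torsion N.
Proof.
case: x => x xT /=; have /asboolP[k xk] := xT; apply/asboolP.
by exists k => a /xk ax; rewrite -linearZ ax linear0.
Qed.

Definition Gamma_map (x : Gamma M) : Gamma N := Submodule (torsion_map x).

Fact Gamma_map_linear : linear Gamma_map.
Proof. by move=> a x y; apply: val_inj; rewrite /= !linearP. Qed.

HB.instance Definition _ :=
  GRing.isLinear.Build R (Gamma M) (Gamma N) _ Gamma_map Gamma_map_linear.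

End Morphism.

Section Complex.
Variable C : cochain_complex R.

Fact Gamma_diffK n (x : Gamma (C n)) :
  Gamma_map (cc_diff C n.+1) (Gamma_map (cc_diff C n) x) = 0.
Proof. by apply: val_inj; rewrite /= cc_diffK. Qed.

Definition Gamma_complex : cochain_complex R :=
  @CochainComplex R (fun n => Gamma (C n)) (fun n => Gamma_map (cc_diff C n))
    Gamma_diffK.

End Complex.

End Torsion.

Section InjectiveResolution.
Variable R : comNzRingType.

Definition injective_module (I : lmodType R) : Prop :=
  forall (A B : lmodType R) (f : {linear A -> B}) (g : {linear A -> I}),
    injective f -> exists h : {linear B -> I}, forall a, h (f a) = g a.

(* 0 -> M -> I^0 -> I^1 -> ... is exact and every I^n is injective. *)
Record injective_resolution (M : lmodType R) := InjectiveResolution {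
  ir_complex :> cochain_complex R;
  ir_aug : {linear M -> ir_complex 0};
  ir_injective : forall n, injective_module (ir_complex n);
  ir_aug_inj : injective ir_aug;
  ir_exact0 : forall x, cc_diff ir_complex 0 x = 0 <-> exists y, ir_aug y = x;
  ir_exact : forall n x, cc_diff ir_complex n.+1 x = 0 <->
    exists y, cc_diff ir_complex n y = x }.

End InjectiveResolution.

(* H^n_J(M), the n-th right derived functor of Gamma_J at M, computed from the *)
(* injective resolution I of M.                                                *)
Definition local_cohomology (R : comNzRingType) (J : {pred R}) (M : lmodType R)
    (I : injective_resolution M) (n : nat) : lmodType R :=
  cohomology (Gamma_complex J I) n.

(* Main.v *)
(* Let E be a nonzero highly divisible submodule of H = H^d_m(R), and let x be *)
(* the n-th powers of an R-regular sequence of length d in m; it is a system   *)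
(* of parameters since dim R = d.  Choose e <> 0 in the                        *)
(* socle of E and W <= H maximal among the submodules avoiding e, so that      *)
(* T = H / W has simple socle.  Every nonzero r in R is a parameter or a unit, *)
(* hence rE = E; as e is not in W, r |-> r (E -> T) embeds R in F = Hom(E, T). *)
(* Completeness makes F finitely generated, and surjectivity of the x_i on the *)
(* successive annihilators in E gives, by additivity and nonnegativity of      *)
(* Northcott's multiplicity e(x; -),                                           *)
(*   length R/(x) = e(x; R) <= e(x; F) <= length Hom(Ann_E(x), T)              *)
(*                <= length Ann_E(x).                                          *)
(* On the other hand Ann_H(x) is a quotient of R/(x), by Rees' computation of  *)
(* Ext(R/(x), R), so that Ann_E(x) = Ann_H(x).  Since every element of H is    *)
(* killed by large powers of the parameters, E = H.  No Matlis duality is      *)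
(* used: T plays the role of the injective hull of the residue field.          *)

Require Import Defs.
From HB Require Import structures.
From mathcomp Require Import all_boot all_order all_algebra.
From mathcomp Require Import generic_quotient ring_quotient.
From mathcomp Require Import boolp classical_sets functions.
From mathcomp Require Import ring.
Import Order.TTheory GRing.Theory Num.Theory.
Local Open Scope ring_scope.

Set Implicit Arguments.
Unset Strict Implicit.
Unset Printing Implicit Defensive.

(** Write H for the top local cohomology and N[x] for the elements of N killed by a sequence x.
    Every element of H is killed by a power of the maximal ideal, so it is enough that a nonzero
    highly divisible E contains H[x] for x the high powers of a maximal regular sequence. This is a
    comparison of lengths, assembled in [top_local_cohomology_killed].

    Upper bound: H[x] is cyclic and killed by (x), hence no longer than R/(x). This is
    [top_local_cohomology_cyclic]; it rests on the degree shift [cyclic_cohomology_kill] and on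
    [cob_lift_seq], which lifts classes killed by x to cocycles killed by x.

    Lower bound: R/(x) is no longer than E[x] ([len_regular_le]). Put T = H/W with simple socle and
    F = Hom(E, T). In a domain every nonzero r is a unit or a parameter ([parameter_extends]), so rE
    = E and R embeds in F. Divisibility of E makes x_1 injective on F and embeds F/x_1F in
    Hom(E[x_1], T) ([homs_nzd], [homs_restr_ker]). By induction the multiplicity of F is at most the
    length of Hom(E[x], T) ([mult_homs]), which is at most that of E[x] ([chain_homs]). The
    multiplicity is monotone by [mult_add] and [mult_ge0], and on R it is the length of R/(x) by
    [mult_regular]. Completeness serves to show that F is noetherian ([noeth_homs]).

    Hence E[x] and H[x] have the same length and coincide. *)

Record submod (R : comNzRingType) (V : lmodType R) := Submod {
  smem :> V -> Prop;
  smem0 : smem 0;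
  smemD : forall u v, smem u -> smem v -> smem (u + v);
  smemZ : forall a v, smem v -> smem (a *: v) }.

Definition sle (R : comNzRingType) (V : lmodType R) (A B : submod V) : Prop :=
  forall v, A v -> B v.
Notation "A '<=s' B" := (sle A B) (at level 70, no associativity).

(** * The modular lattice of submodules *)

Section SubmodTheory.
Variables (R : comNzRingType) (V : lmodType R).
Implicit Types (A B C D : submod V) (u v : V).

(** Membership is a proposition and closure proofs are irrelevant, so mutual inclusion gives an
    equality that can be rewritten. A subquotient A / B is handled as the nested pair [A], [B]. *)
Lemma submod_eqP A B : A <=s B -> B <=s A -> A = B.
Proof.
case: A => a a0 aD aZ; case: B => b b0 bD bZ AB BA.
have eab : a = b by apply/funext => v; apply/propext; split; [apply: AB|apply: BA].
subst b.
by congr Submod; apply: Prop_irrelevance.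
Qed.

Lemma sle_refl A : A <=s A. Proof. by []. Qed.
Lemma sle_trans B A C : A <=s B -> B <=s C -> A <=s C.
Proof. by move=> AB BC v /AB /BC. Qed.

Lemma smemN A v : A v -> A (- v).
Proof. by rewrite -scaleN1r; apply: smemZ. Qed.
Lemma smemB A u v : A u -> A v -> A (u - v).
Proof. by move=> Au Av; apply: smemD => //; apply: smemN. Qed.
Lemma smem_addl A u v : A v -> A (u + v) -> A u.
Proof. by move=> Av Auv; rewrite -(addrK v u); apply: smemB. Qed.
Lemma smem_sum A (I : Type) (r : seq I) (P : pred I) (f : I -> V) :
  (forall i, P i -> A (f i)) -> A (\sum_(i <- r | P i) f i).
Proof. by move=> Af; elim/big_ind: _ => //; [apply: smem0|apply: smemD]. Qed.

Definition szero : submod V.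
Proof.
by exists (fun v => v = 0) => // [u v -> ->|a v ->]; rewrite ?addr0 ?scaler0.
Defined.

Definition sfull : submod V.
Proof. by exists (fun _ => True). Defined.

Definition sadd A B : submod V.
Proof.
exists (fun v => exists a b, [/\ A a, B b & v = a + b]).
- by exists 0, 0; split; rewrite ?addr0 //; apply: smem0.
- move=> _ _ [a [b [Aa Bb ->]]] [a' [b' [Aa' Bb' ->]]].
  by exists (a + a'), (b + b'); split; [apply: smemD|apply: smemD|rewrite addrACA].
- move=> c _ [a [b [Aa Bb ->]]].
  by exists (c *: a), (c *: b); split; [apply: smemZ|apply: smemZ|rewrite scalerDr].
Defined.

Definition scap A B : submod V.
Proof.
exists (fun v => A v /\ B v).
- by split; apply: smem0.
- by move=> u v [Au Bu] [Av Bv]; split; apply: smemD.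
- by move=> a v [Av Bv]; split; apply: smemZ.
Defined.

Lemma sle0 A : szero <=s A. Proof. by move=> _ ->; apply: smem0. Qed.
Lemma sle_addl A B : A <=s sadd A B.
Proof. by move=> v Av; exists v, 0; split; rewrite ?addr0 //; apply: smem0. Qed.
Lemma sle_addr A B : B <=s sadd A B.
Proof. by move=> v Bv; exists 0, v; split; rewrite ?add0r //; apply: smem0. Qed.
Lemma sadd_lub A B C : A <=s C -> B <=s C -> sadd A B <=s C.
Proof. by move=> AC BC _ [a [b [/AC Ca /BC Cb ->]]]; apply: smemD. Qed.
Lemma sadd_mono A B A' B' : A <=s A' -> B <=s B' -> sadd A B <=s sadd A' B'.
Proof. by move=> AA BB _ [a [b [/AA Aa /BB Bb ->]]]; exists a, b. Qed.
Lemma scap_lel A B : scap A B <=s A. Proof. by move=> v []. Qed.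
Lemma scap_ler A B : scap A B <=s B. Proof. by move=> v []. Qed.
Lemma scap_glb A B C : C <=s A -> C <=s B -> C <=s scap A B.
Proof. by move=> CA CB v Cv; split; [apply: CA|apply: CB]. Qed.
Lemma sadd_idl A B : A <=s B -> sadd A B = B.
Proof. by move=> AB; apply: submod_eqP; [apply: sadd_lub|apply: sle_addr]. Qed.
Lemma sadd_idr A B : B <=s A -> sadd A B = A.
Proof. by move=> AB; apply: submod_eqP; [apply: sadd_lub|apply: sle_addl]. Qed.
Lemma sadd0 A : sadd A szero = A.
Proof. by apply: sadd_idr; apply: sle0. Qed.
Lemma scap_idl A B : A <=s B -> scap A B = A.
Proof. by move=> AB; apply: submod_eqP; [apply: scap_lel|apply: scap_glb]. Qed.

(** The modular law. It allows strictness and maximality to be tested separately on the image modulo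
    [B] and on the trace on [B]. *)
Lemma sle_modular A A' B : A <=s A' -> sadd A' B <=s sadd A B ->
  scap A' B <=s scap A B -> A' <=s A.
Proof.
move=> AA' addAB capAB v A'v.
have [a [b [Aa Bb Ev]]] := addAB v (@sle_addl A' B v A'v).
rewrite Ev; apply: smemD => //.
apply: (@scap_lel A B b); apply: capAB; split=> //.
by apply: (@smem_addl _ _ a); [apply: AA'|rewrite addrC -Ev].
Qed.

End SubmodTheory.

Arguments szero {R V}.
Arguments sfull {R V}.

(** * Images, preimages and the correspondence theorem *)

Section Maps.
Variables (R : comNzRingType).

Definition homothety (V : lmodType R) (x : R) (v : V) : V := x *: v.
Fact homothety_linear V x : linear (@homothety V x).
Proof. by move=> a u v; rewrite /homothety scalerDr !scalerA mulrC. Qed.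
HB.instance Definition _ (V : lmodType R) x :=
  GRing.isLinear.Build R V V _ (@homothety V x) (@homothety_linear V x).

Definition orbit_map (V : lmodType R) (v : V) (r : R^o) : V := (r : R) *: v.
Fact orbit_map_linear V v : linear (@orbit_map V v).
Proof. by move=> a r s; rewrite /orbit_map scalerDl scalerA. Qed.
HB.instance Definition _ (V : lmodType R) (v : V) :=
  GRing.isLinear.Build R R^o V _ (@orbit_map V v) (@orbit_map_linear V v).

Lemma homothetyE (V : lmodType R) x (v : V) :
  (@homothety V x : {linear V -> V}) v = x *: v.
Proof. by []. Qed.
Lemma orbit_mapE (V : lmodType R) (v : V) (r : R^o) :
  (orbit_map v : {linear R^o -> V}) r = (r : R) *: v.
Proof. by []. Qed.

Definition simg (V W : lmodType R) (f : {linear V -> W}) (A : submod V) : submod W.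
Proof.
exists (fun w => exists2 v, A v & w = f v).
- by exists 0; [apply: smem0|rewrite linear0].
- by move=> _ _ [u Au ->] [v Av ->]; exists (u + v); [apply: smemD|rewrite linearD].
- by move=> a _ [v Av ->]; exists (a *: v); [apply: smemZ|rewrite linearZ].
Defined.

Definition spre (V W : lmodType R) (f : {linear V -> W}) (B : submod W) : submod V.
Proof.
exists (fun v => B (f v)).
- by rewrite linear0; apply: smem0.
- by move=> u v Bu Bv; rewrite linearD; apply: smemD.
- by move=> a v Bv; rewrite linearZ; apply: smemZ.
Defined.

Definition smul (V : lmodType R) (x : R) (A : submod V) : submod V :=
  simg (@homothety V x) A.
Definition scolon (V : lmodType R) (B : submod V) (x : R) : submod V :=
  spre (@homothety V x) B.
Definition scyc (V : lmodType R) (v : V) : submod V := simg (orbit_map v) sfull.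

(** The image of [A] in W / D, kept as a submodule of [W] containing [D]. *)
Definition push (V W : lmodType R) (f : {linear V -> W}) (D : submod W)
  (A : submod V) : submod W := sadd (simg f A) D.

Lemma smul_le (V : lmodType R) x (A : submod V) : smul x A <=s A.
Proof. by move=> _ [v Av ->]; apply: smemZ. Qed.
Lemma smul_mono (V : lmodType R) x (A B : submod V) : A <=s B -> smul x A <=s smul x B.
Proof. by move=> AB _ [v /AB Bv ->]; exists v. Qed.
Lemma scolon_le (V : lmodType R) x (A : submod V) : A <=s scolon A x.
Proof. by move=> v Av; apply: (smemZ x Av). Qed.
Lemma scyc_id (V : lmodType R) (v : V) : scyc v v.
Proof. by exists 1 => //; rewrite /= /orbit_map scale1r. Qed.
Lemma scyc_le (V : lmodType R) (v : V) (A : submod V) : A v -> scyc v <=s A.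
Proof. by move=> Av _ [r _ ->]; apply: smemZ. Qed.
Lemma push_mono (V W : lmodType R) (f : {linear V -> W}) D (A B : submod V) :
  A <=s B -> push f D A <=s push f D B.
Proof. by move=> AB; apply: sadd_mono => // _ [v /AB Bv ->]; exists v. Qed.
Lemma push_geD (V W : lmodType R) (f : {linear V -> W}) D (A : submod V) :
  D <=s push f D A.
Proof. exact: sle_addr. Qed.

(** The kernel of A -> W / D lies in [B], so nothing is lost in the image. With [pre_push] this
    identifies the submodules between [B] and [A] with those between their images. *)
Lemma push_pre (V W : lmodType R) (f : {linear V -> W}) D (A B : submod V) :
  B <=s A -> scap A (spre f D) <=s B -> scap A (spre f (push f D B)) = B.
Proof.
move=> BA kB; apply: submod_eqP.
  move=> a [Aa [_ [d [[b Bb ->] Dd /= Efa]]]].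
  apply: (@smem_addl _ _ _ _ (- b)); first exact: smemN.
  apply: kB; split; first by apply: smemB => //; apply: BA.
  by rewrite /= linearB /= Efa addrC addKr.
move=> b Bb; split; first exact: BA.
by apply: sle_addl; exists b.
Qed.

Lemma pre_push (V W : lmodType R) (f : {linear V -> W}) D (A : submod V) (X : submod W) :
  D <=s X -> X <=s push f D A -> push f D (scap A (spre f X)) = X.
Proof.
move=> DX XA; apply: submod_eqP.
  by apply: sadd_lub => // _ [a [_ Xa] ->].
move=> v Xv; have [_ [d [[a Aa ->] Dd Ev]]] := XA v Xv.
exists (f a), d; split=> //; exists a => //; split=> //=.
by apply: (@smem_addl _ _ _ _ d); [apply: DX|rewrite -Ev].
Qed.

End Maps.

(** * Length *)

Section Length.
Variable R : comNzRingType.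

(** The last term only has to contain [B], which makes the notion monotone in both ends. *)
Fixpoint chain (V : lmodType R) n (A B : submod V) : Prop :=
  if n is n'.+1 then exists C, [/\ C <=s A, C <> A & chain n' C B] else B <=s A.

Definition finlen (V : lmodType R) (A B : submod V) : Prop :=
  exists N, forall n, chain n A B -> (n <= N)%N.

Definition maximum (P : nat -> Prop) : nat :=
  if pselect (exists n, P n /\ forall k, P k -> (k <= n)%N) is left h
  then projT1 (cid h) else 0%N.

(* Junk value: 0 if the chains are unbounded. *)
Definition len (V : lmodType R) (A B : submod V) : nat :=
  maximum (fun n => chain n A B).

Variable V : lmodType R.
Implicit Types (A B C D : submod V).

Lemma chain_le n A B : chain n A B -> B <=s A.
Proof. by elim: n A => //= n IH A [C [CA _ /IH BC]]; apply: sle_trans CA. Qed.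

Lemma chain_mono n A B A' B' : A <=s A' -> B' <=s B -> chain n A B -> chain n A' B'.
Proof.
elim: n A A' => [|n IH] A A' AA' BB' /=.
  by move=> BA; apply: sle_trans AA'; apply: sle_trans BA.
case=> C [CA CnA cC]; exists C; split; first exact: sle_trans AA'.
  by move=> E; apply: CnA; apply: submod_eqP => //; rewrite E.
exact: IH cC.
Qed.

Lemma chain_cat p q A B C : chain p A B -> chain q B C -> chain (p + q) A C.
Proof.
elim: p A => [|p IH] A /=; first by move=> BA; apply: chain_mono.
by case=> D [DA DnA cD] cB; exists D; split=> //; apply: IH.
Qed.

(** By the modular law each strict step stays strict either after adding [B] or after intersecting
    with [B]. *)
Lemma chain_split n A B C : C <=s B -> chain n A C ->
  exists p q, [/\ (n <= p + q)%N, chain p (sadd A B) B & chain q (scap A B) C].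
Proof.
move=> CB; elim: n A => [|n IH] A /=.
  by move=> CA; exists 0%N, 0%N; split=> //=; [apply: sle_addr|apply: scap_glb].
case=> A1 [A1A A1nA /IH[p [q [npq cp cq]]]].
have addA : sadd A1 B <=s sadd A B by apply: sadd_mono.
have capA : scap A1 B <=s scap A B by move=> v [/A1A ? ?].
have [Eadd|nadd] := pselect (sadd A1 B = sadd A B); last first.
  exists p.+1, q; split; rewrite ?addSn ?ltnS //; last exact: chain_mono cq.
  by exists (sadd A1 B).
exists p, q.+1; split; rewrite ?addnS ?ltnS //; first by rewrite -Eadd.
exists (scap A1 B); split=> // Ecap; apply: A1nA; apply: submod_eqP => //.
by apply: (@sle_modular _ _ A1 A B); rewrite ?Eadd ?Ecap.
Qed.

Lemma maximumP (P : nat -> Prop) N : P 0%N -> (forall n, P n -> (n <= N)%N) ->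
  P (maximum P) /\ forall k, P k -> (k <= maximum P)%N.
Proof.
move=> P0 PN; rewrite /maximum; case: pselect => [h|[]]; first by case: (cid h).
have exP : exists n, `[< P n >] by exists 0%N; apply/asboolP.
have leN n : `[< P n >] -> (n <= N)%N by move/asboolP; apply: PN.
exists (ex_maxn exP leN); case: ex_maxnP => n /asboolP Pn max; split=> // k Pk.
by apply: max; apply/asboolP.
Qed.

Lemma lenP A B : B <=s A -> finlen A B ->
  chain (len A B) A B /\ forall k, chain k A B -> (k <= len A B)%N.
Proof. by move=> BA [N leN]; apply: maximumP leN. Qed.

Lemma finlen_sub A B A' B' : A' <=s A -> B <=s B' -> finlen A B -> finlen A' B'.
Proof. by move=> AA BB [N leN]; exists N => n cn; apply: leN; apply: chain_mono cn. Qed.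

Lemma finlen_cat A B C : C <=s B -> B <=s A -> finlen A B -> finlen B C -> finlen A C.
Proof.
move=> CB BA [N leN] [N' leN']; exists (N + N')%N => n.
move=> /(chain_split CB)[p [q [npq]]].
rewrite (sadd_idr BA) => /leN pN /(chain_mono (@scap_ler _ _ _ _) (@sle_refl _ _ _)) /leN' qN.
exact: leq_trans npq (leq_add pN qN).
Qed.

Lemma len_add A B C : C <=s B -> B <=s A -> finlen A C ->
  len A C = (len A B + len B C)%N.
Proof.
move=> CB BA fAC.
have [cAC mAC] := lenP (sle_trans CB BA) fAC.
have [cAB mAB] := lenP BA (finlen_sub (@sle_refl _ _ _) CB fAC).
have [cBC mBC] := lenP CB (finlen_sub BA (@sle_refl _ _ _) fAC).
apply/eqP; rewrite eqn_leq; apply/andP; split; last exact/mAC/chain_cat/cBC.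
have [p [q [npq]]] := chain_split CB cAC.
rewrite (sadd_idr BA) => /mAB pN /(chain_mono (@scap_ler _ _ _ _) (@sle_refl _ _ _)) /mBC qN.
exact: leq_trans npq (leq_add pN qN).
Qed.

Lemma len_id A : len A A = 0%N.
Proof.
have bnd n : chain n A A -> (n <= 0)%N.
  case: n => // n [C [CA CnA /chain_le AC]].
  by case: CnA; apply: submod_eqP.
have [c _] := @lenP A A (@sle_refl _ _ _) (ex_intro _ 0%N bnd).
by apply/eqP; rewrite -leqn0; apply: bnd.
Qed.

Lemma finlen_id A : finlen A A.
Proof.
exists 0%N; case=> // n [C [CA CnA /chain_le AC]].
by case: CnA; apply: submod_eqP.
Qed.

End Length.

Section LengthPush.
Variables (R : comNzRingType) (V W : lmodType R) (f : {linear V -> W}) (D : submod W).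
Implicit Types (A B C : submod V) (X Y : submod W).

Lemma chain_push n A B : B <=s A -> scap A (spre f D) <=s B ->
  chain n A B -> chain n (push f D A) (push f D B).
Proof.
elim: n A => [|n IH] A BA kB /=; first by move=> _; apply: push_mono.
case=> C [CA CnA cC]; have BC := chain_le cC.
have kC : scap C (spre f D) <=s B by move=> v [/CA ? ?]; apply: kB.
exists (push f D C); split; [exact: push_mono| |exact: IH].
move=> E; apply: CnA.
rewrite -(@push_pre _ _ _ f D A C) //; last exact: sle_trans BC.
by rewrite E push_pre //; apply: scap_lel.
Qed.

Lemma chain_pull n A X Y : D <=s Y -> X <=s push f D A -> chain n X Y ->
  chain n (scap A (spre f X)) (scap A (spre f Y)).
Proof.
move=> DY; elim: n X => [|n IH] X XA /=; first by move=> YX v [Av /YX].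
case=> C [CX CnX cC]; exists (scap A (spre f C)); split.
- by move=> v [Av /CX].
- move=> E; apply: CnX; have DC := sle_trans DY (chain_le cC).
  rewrite -(@pre_push _ _ _ f D A C) //; last exact: sle_trans XA.
  by rewrite E pre_push //; apply: sle_trans CX.
- by apply: IH => //; apply: sle_trans XA.
Qed.

Lemma chain_pushE n A B : B <=s A -> scap A (spre f D) <=s B ->
  chain n (push f D A) (push f D B) <-> chain n A B.
Proof.
move=> BA kB; split; last exact: chain_push.
move=> /(chain_pull (@push_geD _ _ _ _ _ _) (@sle_refl _ _ _)).
by rewrite (push_pre BA kB) push_pre //; apply: scap_lel.
Qed.

Lemma len_push A B : B <=s A -> scap A (spre f D) <=s B ->
  len (push f D A) (push f D B) = len A B.
Proof.
by move=> BA kB; congr maximum; apply/funext => n; apply/propext/chain_pushE.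
Qed.

End LengthPush.

(** * Noetherian intervals of submodules *)

Section Noeth.
Variables (R : comNzRingType) (V : lmodType R).
Implicit Types (A B C D : submod V).

(* The quotient A / B is noetherian. *)
Definition noeth A B : Prop :=
  forall P : submod V -> Prop, (forall C, P C -> B <=s C /\ C <=s A) ->
  (exists C, P C) -> exists2 C, P C & forall D, P D -> C <=s D -> D = C.

Lemma noeth_sub A B A' B' : A' <=s A -> B <=s B' -> noeth A B -> noeth A' B'.
Proof.
move=> AA BB nAB P PAB; apply: nAB => C /PAB[BC CA].
by split; [apply: sle_trans BC|apply: sle_trans AA].
Qed.

(** Choose a member whose image modulo [B] is maximal, then, among the members above it, one whose
    trace on [B] is maximal; the modular law makes the latter maximal. *)
Lemma noeth_cat A B C : C <=s B -> B <=s A -> noeth A B -> noeth B C -> noeth A C.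
Proof.
move=> CB BA nAB nBC P PAC [X0 PX0].
pose P1 Y := exists2 X, P X & Y = sadd X B.
have [||Y1 [X1 PX1 EY1] max1] := nAB P1.
- by move=> _ [X /PAC[_ XA] ->]; split; [apply: sle_addr|apply: sadd_lub].
- by exists (sadd X0 B), X0.
pose P2 Y := exists X, [/\ P X, X1 <=s X & Y = scap X B].
have [||Y2 [X2 [PX2 X12 EY2]] max2] := nBC P2.
- move=> _ [X [/PAC[CX _] _ ->]].
  by split; [apply: scap_glb|apply: scap_ler].
- by exists (scap X1 B), X1; split.
exists X2 => // D PD X2D; apply: submod_eqP => //.
apply: (@sle_modular _ _ X2 D B) => //.
  rewrite (max1 (sadd D B)); [by rewrite EY1; apply: sadd_mono|by exists D|].
  by rewrite EY1; apply: sadd_mono => //; apply: sle_trans X12 X2D.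
rewrite (max2 (scap D B)); [by rewrite EY2| |by rewrite EY2 => v [/X2D ? ?]].
by exists D; split=> //; apply: sle_trans X12 X2D.
Qed.

Lemma noeth_id A : noeth A A.
Proof.
move=> P PA [C PC]; exists C => // D PD CD.
have [[AC CA] [AD DA]] := (PA _ PC, PA _ PD).
by apply: submod_eqP => //; apply: sle_trans AC.
Qed.

(** The base grows along the sequence, so that [sgen J (x :: s)] is convertible to
    [sgen (sadd J (scyc x)) s]; the inductions on parameter sequences rely on this. *)
Fixpoint sgen A (s : seq V) : submod V :=
  if s is v :: s' then sgen (sadd A (scyc v)) s' else A.

Lemma sgen_ge A s : A <=s sgen A s.
Proof.
by elim: s A => [|v s IH] A //=; apply: sle_trans (IH _); apply: sle_addl.
Qed.

Lemma sgen_le A B s : A <=s B -> (forall v, v \in s -> B v) -> sgen A s <=s B.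
Proof.
elim: s A => //= v s IH A AB sB; apply: IH => [|w ws]; last first.
  by apply: sB; rewrite inE ws orbT.
by apply: sadd_lub => //; apply/scyc_le/sB; rewrite inE eqxx.
Qed.

Lemma sgen_mem A s v : v \in s -> sgen A s v.
Proof.
elim: s A => //= w s IH A; rewrite inE => /orP[/eqP <-|/IH]; last exact.
by apply: sgen_ge; apply: sle_addr; apply: scyc_id.
Qed.

Lemma sgen_cat A s t : sgen A (s ++ t) = sgen (sgen A s) t.
Proof. by elim: s A => //= v s IH A. Qed.

(** A maximal finitely generated extension of [B] inside [A] is [A], since otherwise one more
    generator would enlarge it. *)
Lemma noeth_sgen A B : B <=s A -> noeth A B -> exists s, A = sgen B s.
Proof.
move=> BA nAB; pose P C := C <=s A /\ exists s, C = sgen B s.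
have [||C [CA [s EC]] max] := nAB P.
- by move=> C [CA [s EC]]; split=> //; rewrite EC; apply: sgen_ge.
- by exists B; split=> //; exists [::].
subst C; exists s; apply: submod_eqP => // v Av.
rewrite -(max (sgen B (rcons s v))); last 1 first.
- by rewrite -cats1 sgen_cat; apply: sgen_ge.
- by apply: sgen_mem; rewrite mem_rcons inE eqxx.
split; last by exists (rcons s v).
rewrite -cats1 sgen_cat; apply: sgen_le => // w; rewrite inE => /eqP ->.
exact: Av.
Qed.

End Noeth.

Lemma noeth_push (R : comNzRingType) (V W : lmodType R) (f : {linear V -> W})
    (D : submod W) (A B : submod V) :
  noeth A B -> B <=s A -> noeth (push f D A) (push f D B).
Proof.
move=> nAB BA P PAB [X0 PX0].
pose P' C := exists2 X, P X & C = scap A (spre f X).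
have PD X : P X -> D <=s X by move=> /PAB[BX _]; apply: sle_trans BX; apply: push_geD.
have [||C [X PX EC] max] := nAB P'.
- move=> _ [X PX ->]; split; last exact: scap_lel.
  move=> b Bb; split; first exact: BA.
  by apply: (PAB _ PX).1; apply: sle_addl; exists b.
- by exists (scap A (spre f X0)), X0.
subst C; exists X => // Y PY XY.
rewrite -(@pre_push _ _ _ f D A Y (PD Y PY) (PAB _ PY).2).
rewrite (max (scap A (spre f Y))); [|by exists Y|by move=> v [Av /XY]].
exact: pre_push (PD X PX) (PAB _ PX).2.
Qed.

Lemma noeth_sgenS (R : comNzRingType) (V : lmodType R) (B : submod V) s :
  noeth (sfull : submod R^o) szero -> noeth (sgen B s) B.
Proof.
move=> nR; elim: s B => [|v s IH] B /=; first exact: noeth_id.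
apply: (@noeth_cat _ _ _ (sadd B (scyc v))); [exact: sle_addl|exact: sgen_ge|exact: IH|].
have := @noeth_push _ _ _ (orbit_map v) B _ _ nR (@sle0 _ _ _).
apply: noeth_sub => [w [b [c [Bb vc ->]]]|]; first by exists c, b; rewrite addrC.
by apply: sadd_lub => // _ [_ -> ->]; rewrite linear0; apply: smem0.
Qed.

(** * Generated ideals and the noetherian hypothesis in terms of [submod] *)

Section SubmodPred.
Variables (R : comNzRingType) (V : lmodType R) (A : submod V).

Definition submod_mem (v : V) : bool := `[< A v >].

Fact submod_mem_closed : GRing.subsemimod_closed submod_mem.
Proof.
split; first split.
- exact/asboolP/smem0.
- by move=> u v /asboolP Au /asboolP Av; apply/asboolP/smemD.
- by move=> a v /asboolP Av; apply/asboolP/smemZ.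
Qed.

HB.instance Definition _ := GRing.isSubmodClosed.Build R V submod_mem submod_mem_closed.

Definition submod_closed_of : submodClosed V := GRing.SubmodClosed.clone R V submod_mem _.

Lemma submod_closed_ofP v : reflect (A v) (v \in submod_closed_of).
Proof. exact: asboolP. Qed.

End SubmodPred.

Lemma sgen_sumP (R : comNzRingType) (V : lmodType R) (A : submod V) (s : seq V) v :
  sgen A s v ->
  exists a (c : nat -> R), A a /\ v = a + \sum_(i < size s) c i *: s`_i.
Proof.
elim: s A => [|w s IH] A /=.
  by exists v, (fun=> 0); rewrite big_ord0 addr0.
move=> /IH[_ [c [[a [_ [Aa [r _ ->] ->]]] ->]]].
exists a, (fun i => if i is k.+1 then c k else r); split=> //.
by rewrite big_ord_recl /= addrA.
Qed.

Lemma ideal_genP (R : comNzRingType) (s : seq R) a :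
  reflect (sgen (szero : submod R^o) s a) (a \in ideal_gen s).
Proof.
apply: (iffP idP) => [/asboolP[c ->]|/sgen_sumP[_ [c [-> ->]]]].
  apply: smem_sum => i _; apply: (@smemZ _ _ (sgen (szero : submod R^o) s)).
  by apply: sgen_mem; apply: mem_nth.
by apply/asboolP; exists c; rewrite add0r.
Qed.

(** Without a maximal member, choice gives a strictly increasing sequence of ideals. Its union is
    finitely generated, the generators lie in one term, and the sequence stops there. *)
Lemma noetherian_noeth (R : comNzRingType) :
  noetherian R -> noeth (sfull : submod R^o) szero.
Proof.
move=> Rn P _ [C0 PC0]; apply: contrapT => nomax.
have step (X : {C | P C}) : exists Y : {C | P C}, sval X <=s sval Y /\ sval Y <> sval X.
  case: X => X PX /=; apply: contrapT => noY; apply: nomax; exists X => // D PD XD.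
  by apply: contrapT => nDX; apply: noY; exists (exist _ D PD).
have [nxt nxtP] := choice step.
pose F i := sval (iter i nxt (exist _ C0 PC0)).
have Fmono i j : (i <= j)%N -> F i <=s F j.
  by move/subnK <-; elim: (j - i)%N => //= k IH; apply: sle_trans IH (nxtP _).1.
have U : {U : submod R^o | forall v, U v <-> exists i, F i v}.
  unshelve eexists (@Submod _ _ (fun v => exists i, F i v) _ _ _) => //=.
  - by exists 0%N; apply: smem0.
  - move=> u v [i Fu] [j Fv]; exists (maxn i j).
    apply: smemD; first by apply: Fmono Fu; apply: leq_maxl.
    by apply: Fmono Fv; apply: leq_maxr.
  - by move=> a v [i Fv]; exists i; apply: smemZ.
case: U => U UP; have [s Us] := Rn (submod_closed_of U).
have memU v : U v <-> sgen (szero : submod R^o) s v.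
  split=> [/submod_closed_ofP|/ideal_genP]; first by rewrite Us => /ideal_genP.
  by rewrite -Us => /submod_closed_ofP.
have [n sF] : exists n, forall v, v \in s -> F n v.
  have : forall v, v \in s -> U v by move=> v vs; apply/memU/sgen_mem.
  elim: (s) => [|v t IH] tU; first by exists 0%N.
  have [|n nF] := IH; first by move=> w wt; apply: tU; rewrite inE wt orbT.
  have /UP[k Fk] : U v by apply: tU; rewrite inE eqxx.
  exists (maxn n k) => w; rewrite inE => /orP[/eqP ->|/nF].
    by apply: Fmono Fk; apply: leq_maxr.
  by apply: Fmono; apply: leq_maxl.
apply: (nxtP (iter n nxt (exist _ C0 PC0))).2; apply: submod_eqP; last exact: (nxtP _).1.
move=> v Fv; have /memU : U v by apply/UP; exists n.+1.
by apply: sgen_le; first exact: sle0.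
Qed.

(** * Multiplicities *)

Section Mult.
Variable R : comNzRingType.

(* Northcott's multiplicity symbol of x_1, ..., x_n on A / B. *)
Fixpoint mult (V : lmodType R) (s : seq R) (A B : submod V) : int :=
  if s is x :: s' then
    mult s' A (sadd (smul x A) B) - mult s' (scap A (scolon B x)) B
  else (len A B)%:Z.

(** The symbol depends only on A / B up to isomorphism: [push] commutes with forming the cokernel
    and the kernel of multiplication by x. *)
Lemma mult_push (V W : lmodType R) (f : {linear V -> W}) (D : submod W) s
    (A B : submod V) :
  B <=s A -> scap A (spre f D) <=s B ->
  mult s (push f D A) (push f D B) = mult s A B.
Proof.
elim: s A B => [|x s IH] A B BA kB /=; first by rewrite len_push.
rewrite -(IH A (sadd (smul x A) B)); first 1 last.
- by apply: sadd_lub => //; apply: smul_le.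
- by apply: sle_trans kB _; apply: sle_addr.
rewrite -(IH (scap A (scolon B x)) B); first 1 last.
- by apply: scap_glb => //; apply: scolon_le.
- by move=> v [[Av _] Dv]; apply: kB.
congr (@mult W s _ _ - @mult W s _ _); apply: submod_eqP.
- apply: sadd_lub.
    move=> _ [_ [_ [d [[a Aa ->] Dd ->]]] ->].
    rewrite homothetyE scalerDr -linearZ.
    apply: smemD; last exact/smemZ/push_geD.
    apply: sle_addl; exists (x *: a) => //.
    by apply: sle_addl; exists a.
  by apply: push_mono; apply: sle_addr.
- apply: sadd_lub.
    move=> _ [_ [_ [b [[a Aa ->] Bb ->]]] ->].
    rewrite linearD; apply: smemD.
      apply: sle_addl; exists (f a); last by rewrite linearZ.
      by apply: sle_addl; exists a.
    by apply: sle_addr; apply: sle_addl; exists b.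
  by apply: sle_trans (@sle_addr _ _ _ _); apply: push_geD.
- move=> _ [[_ [d [[a Aa ->] Dd ->]]] [_ [d' [[b Bb ->] Dd']]]].
  rewrite homothetyE scalerDr -linearZ => E.
  apply: smemD; last exact: push_geD.
  apply: sle_addl; exists a => //; split=> //=.
  apply: (@smem_addl _ _ _ _ (- b)); first exact: smemN.
  apply: kB; split; first by apply: smemB; [apply: smemZ|apply: BA].
  rewrite /= linearB /= (_ : f (x *: a) - f b = d' - x *: d).
    by apply: smemB => //; apply: smemZ.
  by apply/eqP; rewrite subr_eq addrAC [d' + _]addrC -E addrK.
- apply: sadd_lub; last first.
    move=> d Dd; split; first exact: push_geD.
    by apply: push_geD; apply: (smemZ x Dd).
  move=> _ [a [Aa Ba] ->]; split; first by apply: sle_addl; exists a.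
  by apply: sle_addl; exists (x *: a); rewrite //= /homothety linearZ.
Qed.

Lemma push_id (V : lmodType R) (D A : submod V) : push idfun D A = sadd A D.
Proof.
apply: submod_eqP; apply: sadd_mono => //; first by move=> _ [v Av ->].
by move=> v Av; exists v.
Qed.

Lemma mult_sadd (V : lmodType R) s (A B : submod V) :
  mult s (sadd A B) B = mult s A (scap A B).
Proof.
rewrite -(mult_push (f := idfun) (D := B) s (@scap_lel _ _ A B)) ?push_id //.
by rewrite (sadd_idl (@scap_ler _ _ A B)).
Qed.

(** Multiplication by [x] is an isomorphism from A / B onto (xA + C) / (xB + C). *)
Lemma mult_smul (V : lmodType R) s x (A B C : submod V) :
  B <=s A -> scap A (scolon C x) <=s B ->
  mult s (sadd (smul x A) C) (sadd (smul x B) C) = mult s A B.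
Proof. exact: mult_push. Qed.

Lemma mult_id (V : lmodType R) s (A : submod V) : mult s A A = 0.
Proof.
elim: s A => [|x s IH] A /=; first by rewrite len_id.
by rewrite (sadd_idl (@smul_le _ _ _ _)) (scap_idl (@scolon_le _ _ x A)) IH subrr.
Qed.

(** The kernel and the cokernel of [x] on A / B are both A / B. *)
Lemma mult_killed (V : lmodType R) s x (A B : submod V) :
  smul x A <=s B -> mult (x :: s) A B = 0.
Proof.
move=> xAB /=; rewrite (sadd_idl xAB) scap_idl ?subrr //.
by move=> a Aa; apply: xAB; exists a.
Qed.

Lemma mult_nzd (V : lmodType R) s x (A B : submod V) :
  B <=s A -> scap A (scolon B x) <=s B ->
  mult (x :: s) A B = mult s A (sadd (smul x A) B).
Proof.
move=> BA xB /=; rewrite (_ : scap _ _ = B) ?mult_id ?subr0 //.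
by apply: submod_eqP => // v Bv; split; [apply: BA|apply: scolon_le].
Qed.

Variable M : submod R^o.
Hypothesis M_unit : forall r : R, ~ M r -> exists u : R, u * r = 1.
Hypothesis R_noeth : noeth (sfull : submod R^o) szero.

(** This only asks that [M] lie in the radical of [J]; the unit ideal qualifies. *)
Definition primary (J : submod R^o) : Prop :=
  forall y : R, M y -> exists k, J (y ^+ k).

Definition annihilates (V : lmodType R) (J : submod R^o) (A B : submod V) : Prop :=
  forall c v, J c -> A v -> B ((c : R) *: v).

(** The quotient is cyclic and killed by [M], so it is zero or simple. *)
Lemma chain_simple (V : lmodType R) n (B : submod V) v :
  (forall y : R, M y -> B (y *: v)) -> chain n (sadd B (scyc v)) B -> (n <= 1)%N.
Proof.
move=> MB; case: n => [|[|n]] // [C [CA CnA [D [DC DnC /chain_le BD]]]].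
case: DnC; apply: submod_eqP => // c Cc.
have [b [_ [Bb [r _ ->] Ec]]] := CA c Cc; rewrite Ec; apply: smemD; first exact: BD.
have [Mr|nMr] := pselect (M r); first exact/BD/MB.
case: CnA; apply: submod_eqP => //.
apply: sadd_lub; first exact: sle_trans DC.
have Crv : C (r *: v) by rewrite -(addKr b (r *: v)) -Ec addrC; apply: smemB => //; apply/DC/BD.
apply: scyc_le; have [u ur] := M_unit nMr.
by rewrite -(scale1r v) -ur -scalerA; apply: smemZ.
Qed.

(** Take [C] maximal with C / B of finite length. If [C] is not [A], an element [a] outside [C] with
    maximal annihilator modulo [C] is sent into [C] by [M], and adding it to [C] increases the
    length by at most one. *)
Lemma finlen_primary (V : lmodType R) (J : submod R^o) (A B : submod V) :
  B <=s A -> noeth A B -> annihilates J A B -> primary J -> finlen A B.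
Proof.
move=> BA nAB JAB primJ; pose P C := [/\ B <=s C, C <=s A & finlen C B].
have [||C [BC CA finC] max] := nAB P.
- by move=> C [].
- by exists B; split=> //; apply: finlen_id.
have [AleC|nAleC] := pselect (A <=s C); first exact: finlen_sub AleC (@sle_refl _ _ _) finC.
pose Q (I : submod R^o) := exists a, [/\ A a, ~ C a & I = spre (orbit_map a) C].
have [||I [a [Aa nCa EI]] maxI] := R_noeth (P := Q).
- by move=> I _; split=> //; apply: sle0.
- have [a /not_implyP[Aa nCa]] : exists a, ~ (A a -> C a) by apply/existsNP.
  by exists (spre (orbit_map a) C), a.
have MC (y : R) : M y -> C (y *: a).
  (* If [y *: a] is outside [C], it has the same annihilator modulo [C] as [a]. A power of [y] sends
     [a] into [C], and the exponent can then be lowered to 0. *)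
  move=> My; apply: contrapT => nCya.
  have EIy : spre (orbit_map (y *: a)) C = I.
    apply: maxI; first by exists (y *: a); split=> //; apply: smemZ.
    rewrite EI => r /= Cra; rewrite /orbit_map scalerA mulrC -scalerA.
    exact: smemZ.
  have [k /JAB/(_ Aa)/BC] := primJ y My; elim: k => [|k IH].
    by rewrite expr0 scale1r.
  rewrite exprSr -scalerA => Ck; apply: IH.
  have : I (y ^+ k) by rewrite -EIy.
  by rewrite EI.
case: nCa; rewrite -(max (sadd C (scyc a))); last exact: sle_addl.
  by apply: sle_addr; apply: scyc_id.
split; [exact: sle_trans (@sle_addl _ _ _ _)|by apply: sadd_lub => //; apply: scyc_le|].
apply: finlen_cat finC => //; first exact: sle_addl.
by exists 1%N => n; apply: chain_simple.
Qed.

Lemma finlen_noeth (V : lmodType R) (A B : submod V) : finlen A B -> noeth A B.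
Proof.
case=> N leN P PAB [C0 PC0].
pose Q n := `[< exists2 C, P C & chain n C B >].
have exQ : exists n, Q n by exists 0%N; apply/asboolP; exists C0 => //; case: (PAB C0).
have QN n : Q n -> (n <= N)%N.
  case/asboolP=> C /PAB[_ CA] cC; apply: leN.
  exact: chain_mono CA (@sle_refl _ _ _) cC.
case: (ex_maxnP exQ QN) => n /asboolP[C PC cC] max; exists C => // D PD CD.
apply: contrapT => nDC; have /max : Q n.+1; last by rewrite ltnn.
by apply/asboolP; exists D => //; exists C; split=> // E; apply: nDC.
Qed.

(** The invariant of the inductions on [s]. On a subquotient killed by [x], [mult_ok_cons] moves [x]
    from the sequence into [J], which leaves the primary ideal unchanged; once [s] is empty, [J]
    forces finite length. *)
Definition mult_ok (V : lmodType R) (J : submod R^o) (s : seq R) (A B : submod V) : Prop :=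
  [/\ B <=s A, noeth A B, annihilates J A B & primary (sgen J s)].

Lemma mult_ok_sub (V : lmodType R) (J : submod R^o) (s : seq R) (A B A' B' : submod V) :
  B' <=s A' -> A' <=s A -> B <=s B' -> mult_ok J s A B -> mult_ok J s A' B'.
Proof.
move=> BA' AA BB [BA nAB JAB primJ]; split=> //; first exact: noeth_sub nAB.
by move=> c v Jc /AA /(JAB _ _ Jc) /BB.
Qed.

Lemma mult_ok_cons (V : lmodType R) (J : submod R^o) (x : R) (s : seq R) (A B A' B' : submod V) :
  B' <=s A' -> A' <=s A -> B <=s B' -> smul x A' <=s B' ->
  mult_ok J (x :: s) A B -> mult_ok (sadd J (scyc (x : R^o))) s A' B'.
Proof.
move=> BA' AA BB xAB /(mult_ok_sub BA' AA BB)[_ nAB JAB primJ]; split=> //.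
move=> _ v [j [_ [Jj [r _ ->] ->]]] Av; rewrite scalerDl.
apply: smemD; first exact: JAB.
by rewrite /= /orbit_map -scalerA; apply: smemZ; apply: xAB; exists v.
Qed.

(* The three isomorphisms below break up the six-term exact sequence of the  *)
(* snake lemma for multiplication by x on C <= B <= A.                       *)
Lemma mult_add (V : lmodType R) (s : seq R) (J : submod R^o) (A B C : submod V) :
  C <=s B -> B <=s A -> mult_ok J s A C -> mult s A C = mult s A B + mult s B C.
Proof.
elim: s J A B C => [|x s IH] J A B C CB BA ok.
  case: ok => CA nAC JAC primJ.
  by rewrite /= (len_add CB BA) //; apply: finlen_primary JAC primJ.
have CA := sle_trans CB BA.
have add' X Y Z : Z <=s Y -> Y <=s X -> C <=s Z -> X <=s A -> smul x X <=s Z ->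
    mult s X Z = mult s X Y + mult s Y Z.
  move=> ZY YX CZ XA xXZ; apply: IH => //.
  by apply: mult_ok_cons xXZ ok => //; apply: sle_trans YX.
(* Kernels of [x]: K / C, K' / C and K2 / B on A / C, B / C and A / B. Cokernels: A / Q, B / Q' and
   A / Q2. The connecting map K2 / B -> B / Q' has image I / Q' and kernel (K + B) / B. *)
pose K := scap A (scolon C x); pose K' := scap B (scolon C x).
pose K2 := scap A (scolon B x).
pose Q := sadd (smul x A) C; pose Q' := sadd (smul x B) C.
pose Q2 := sadd (smul x A) B; pose I := sadd (smul x K2) C.
have CK' : C <=s K' by apply: scap_glb => //; apply: scolon_le.
have K'K : K' <=s K by move=> v [/BA ? ?].
have xK : smul x K <=s C by move=> _ [v [_ Cv] ->].
have KB2 : sadd K B <=s K2.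
  apply: sadd_lub; first by move=> v [Av /CB].
  by apply: scap_glb => //; apply: scolon_le.
have xK2 : smul x K2 <=s B by move=> _ [v [_ Bv] ->].
have BKB : B <=s sadd K B by apply: sle_addr.
have BK2 : B <=s K2 by apply: sle_trans KB2.
have Q'I : Q' <=s I by apply: sadd_mono => //; apply: smul_mono.
have IB : I <=s B by apply: sadd_lub.
have CQ' : C <=s Q' by apply: sle_addr.
have QQ2 : Q <=s Q2 by apply: sadd_mono.
have Q2A : Q2 <=s A by apply: sadd_lub => //; apply: smul_le.
have K2A : K2 <=s A by apply: scap_lel.
have KA : K <=s A by apply: scap_lel.
have CQ : C <=s Q by apply: sle_addr.
have e1 : mult s K C = mult s K K' + mult s K' C by apply: add'.
have e2 : mult s K2 B = mult s K2 (sadd K B) + mult s (sadd K B) B by apply: add'.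
have e3 : mult s B Q' = mult s B I + mult s I Q'.
  by apply: add' => //; apply: sle_addl.
have e4 : mult s A Q = mult s A Q2 + mult s Q2 Q.
  by apply: add' => //; apply: sle_addl.
have e5 : mult s (sadd K B) B = mult s K K'.
  rewrite mult_sadd; congr (mult s _ _); apply: submod_eqP.
    by move=> v [[_ ?] ?].
  by move=> v [? ?]; split=> //; split=> //; apply: BA.
have e6 : mult s I Q' = mult s K2 (sadd K B).
  rewrite -(@mult_smul _ s x K2 (sadd K B) C) //.
    congr (mult s _ _); apply: submod_eqP.
      by apply: sadd_mono => //; apply: smul_mono.
    apply: sadd_lub; last exact: sle_addr.
    move=> _ [_ [k [b [[_ Ck] Bb ->]]] ->]; rewrite linearD addrC.
    by exists (x *: b), (x *: k); split=> //; exists b.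
  by move=> v [[Av _] Cv]; apply: sle_addl.
have e7 : mult s Q2 Q = mult s B I.
  have -> : Q2 = sadd B Q.
    apply: submod_eqP; last by apply: sadd_lub => //; apply: sle_addr.
    apply: sadd_lub; last exact: sle_addl.
    by apply: sle_trans (@sle_addr _ _ _ _); apply: sle_addl.
  rewrite mult_sadd; congr (mult s _ _); apply: submod_eqP; last first.
    by apply: scap_glb => //; apply: sadd_mono => //; apply: smul_mono.
  move=> v [Bv [_ [c [[a Aa ->] Cc Ev]]]].
  exists (x *: a), c; split=> //; exists a => //; split=> //.
  apply: (@smem_addl _ _ B _ c); first exact: CB.
  by move: Bv; rewrite Ev.
rewrite /= -/K -/K' -/K2 -/Q -/Q' -/Q2 e1 e2 e3 e4 e5 e6 e7.
by ring.
Qed.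

(** The successive quotients of the [x]-power torsion T k are killed by [x] and contribute 0. The
    sequence T k stabilises, and modulo its last term [x] is a nonzerodivisor, which leaves a symbol
    in one variable less. *)
Lemma mult_ge0 (V : lmodType R) (s : seq R) (J : submod R^o) (A B : submod V) :
  mult_ok J s A B -> 0 <= mult s A B.
Proof.
elim: s J A B => [|x s IH] J A B ok //.
pose T k := scap A (scolon B (x ^+ k)).
have [BA nAB _ _] := ok.
have BT k : B <=s T k by apply: scap_glb => //; apply: scolon_le.
have TA k : T k <=s A by apply: scap_lel.
have TS k : T k <=s T k.+1.
  move=> v [Av Bv]; split=> //=; rewrite /homothety exprS -scalerA.
  exact: smemZ.
have mT0 k : mult (x :: s) (T k) B = 0.
  elim: k => [|k IHk].
    rewrite (_ : T 0%N = B) ?mult_id //; apply: submod_eqP => // v [_ /=].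
    by rewrite /homothety expr0 scale1r.
  rewrite (@mult_add _ _ J _ (T k)) //; last exact: mult_ok_sub ok.
  rewrite IHk addr0 mult_killed // => _ [v [Av Bv] ->]; split.
    by apply: smemZ.
  by rewrite /= /homothety scalerA -exprSr.
have [||_ [N ->] max] := nAB (fun C => exists k, C = T k).
- by move=> _ [k ->].
- by exists (T 0%N), 0%N.
rewrite (@mult_add _ _ J _ (T N)) // mT0 addr0 mult_nzd //.
  apply: (IH (sadd J (scyc (x : R^o)))); apply: mult_ok_cons ok => //.
  - by apply: sadd_lub => //; apply: smul_le.
  - by apply: sle_trans (@sle_addr _ _ _ _).
  - exact: sle_addl.
rewrite -[X in _ <=s X](max (T N.+1)) //; last by exists N.+1.
by move=> v [Av [_ Bv]]; split=> //=; rewrite /homothety exprSr -scalerA.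
Qed.

Fixpoint regular (J : submod R^o) (s : seq R) : Prop :=
  if s is x :: s' then
    (forall a : R, J (x * a) -> J a) /\ regular (sadd J (scyc (x : R^o))) s'
  else True.

(** All the kernel terms vanish, so only the length of the last cokernel is left. *)
Lemma mult_regular (J : submod R^o) (s : seq R) : regular J s -> mult s sfull J = (len sfull (sgen J s))%:Z.
Proof.
elim: s J => [|x s IH] J //= [Jx reg_s]; rewrite -IH //.
have -> : scap sfull (scolon J x) = J.
  by apply: submod_eqP => [v [_ /Jx]|v Jv] //; split=> //; apply: scolon_le.
rewrite mult_id subr0; congr (mult s _ _); apply: submod_eqP.
  apply: sadd_lub; last exact: sle_addl.
  move=> _ [r _ ->]; apply: sle_addr; exists r => //.
  exact: (mulrC x r).
apply: sadd_lub; first exact: sle_addr.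
move=> _ [r _ ->]; apply: sle_addl; exists r => //.
exact: (mulrC r x).
Qed.

End Mult.

(** * Duals of divisible modules *)

Section Hom.
Variables (R : comNzRingType) (H T : lmodType R).
Implicit Types (N : submod H) (f : H -> T).

(* Hom(N, T), with homomorphisms extended by 0 outside N. *)
Definition homs N : submod (H -> T).
Proof.
exists (fun f => [/\ forall u v, N u -> N v -> f (u + v) = f u + f v,
                     forall a v, N v -> f (a *: v) = a *: f v
                   & forall v, ~ N v -> f v = 0]).
- by split=> // *; rewrite ?addr0 ?scaler0.
- move=> f g [fD fZ f0] [gD gZ g0]; split=> [u v Nu Nv|a v Nv|v nNv] /=.
  + by rewrite !addrfctE fD // gD // addrACA.
  + by rewrite !addrfctE fZ // gZ // scalerDr.
  + by rewrite !addrfctE f0 // g0 // addr0.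
- move=> c f [fD fZ f0]; split=> [u v Nu Nv|a v Nv|v nNv].
  + by rewrite !scalrfctE fD // scalerDr.
  + by rewrite !scalrfctE fZ // !scalerA mulrC.
  + by rewrite !scalrfctE f0 // scaler0.
Defined.

Definition restr N f : H -> T := fun v => if `[< N v >] then f v else 0.
Fact restr_linear N : linear (restr N).
Proof.
move=> a f g; apply/funext => v; rewrite !addrfctE !scalrfctE /restr /=.
by case: ifP => // _; rewrite scaler0 addr0.
Qed.
HB.instance Definition _ N :=
  GRing.isLinear.Build R (H -> T) (H -> T) _ (restr N) (restr_linear N).

Definition eval_at (v : H) f : T := f v.
Fact eval_at_linear v : linear (eval_at v). Proof. by []. Qed.
HB.instance Definition _ v :=
  GRing.isLinear.Build R (H -> T) T _ (eval_at v) (eval_at_linear v).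

Lemma restrE N f v : N v -> restr N f v = f v.
Proof. by move=> Nv; rewrite /restr asboolT. Qed.
Lemma restr0 N f v : ~ N v -> restr N f v = 0.
Proof. by move=> Nv; rewrite /restr asboolF. Qed.

Lemma restr_homs N N' f : N' <=s N -> homs N f -> homs N' (restr N' f).
Proof.
move=> N'N [fD fZ _]; split=> [u v Nu Nv|a v Nv|v]; last exact: restr0.
- by rewrite !restrE //; [apply: fD; apply: N'N|apply: smemD].
- by rewrite !restrE //; [apply: fZ; apply: N'N|apply: smemZ].
Qed.

Lemma linear_homs N (f : {linear H -> T}) : homs N (restr N f).
Proof.
split=> [u v Nu Nv|a v Nv|v]; last exact: restr0.
- by rewrite !restrE ?linearD //; apply: smemD.
- by rewrite !restrE ?linearZ //; apply: smemZ.
Qed.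

Lemma homs_eq0 N f : homs N f -> (forall v, N v -> f v = 0) -> f = 0.
Proof.
case=> _ _ f0 f0'; apply/funext => v.
by have [/f0'|/f0] := pselect (N v).
Qed.

Definition killed N x : submod H := scap N (scolon szero x).

Section Divisible.
Variables (N : submod H) (x : R).
Hypothesis Nx : forall v, N v -> exists2 w, N w & x *: w = v.

Lemma homs_nzd : scap (homs N) (scolon szero x) <=s szero.
Proof.
move=> f [Nf /= xf]; apply: (homs_eq0 Nf) => v /Nx[w Nw <-].
case: Nf => _ fZ _; rewrite fZ //.
by have := congr1 (fun g => g w) xf.
Qed.

(** A homomorphism that vanishes on the [x]-torsion of [N] factors through the surjection x : N ->
    N, hence is a multiple of [x]. So Hom(N, T) modulo [x] embeds in Hom(N[x], T). *)
Lemma homs_restr_ker :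
  scap (homs N) (spre (restr (killed N x)) szero) <=s smul x (homs N).
Proof.
move=> f [Nf /= f0]; have [fD fZ fN] := Nf.
have fkill v : N v -> x *: v = 0 -> f v = 0.
  by move=> Nv xv; rewrite -(@restrE (killed N x) f v) ?f0 //.
have Nx' v : exists w, N v -> N w /\ x *: w = v.
  by have [/Nx[w Nw <-]|nNv] := pselect (N v); [exists w|exists 0].
have [h hP] := choice Nx'.
have fh v w : N v -> N w -> x *: w = v -> f (h v) = f w.
  move=> Nv Nw xw; have [Nhv xhv] := hP v Nv.
  apply/eqP; rewrite -subr_eq0 -scaleN1r -fZ // -fD //; last exact: smemZ.
  apply/eqP/fkill; first by apply: smemD => //; apply: smemZ.
  by rewrite scalerDr scaleN1r scalerN xhv xw subrr.
exists (restr N (fun v => f (h v))).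
  split=> [u v Nu Nv|a v Nv|v]; last exact: restr0.
  - have [[Nhu xhu] [Nhv xhv]] := (hP u Nu, hP v Nv).
    rewrite !restrE //; last exact: smemD.
    rewrite -fD //; apply: fh; [exact: smemD|exact: smemD|].
    by rewrite scalerDr xhu xhv.
  - have [Nhv xhv] := hP v Nv.
    rewrite !restrE //; last exact: smemZ.
    rewrite -fZ //; apply: fh; [exact: smemZ|exact: smemZ|].
    by rewrite scalerA mulrC -scalerA xhv.
apply/funext => v; rewrite /= /homothety scalrfctE.
have [Nv|nNv] := pselect (N v); last by rewrite restr0 // scaler0 fN.
rewrite restrE // -fZ; last by case: (hP v Nv).
by case: (hP v Nv) => _ ->.
Qed.

End Divisible.

Fixpoint killed_seq N (s : seq R) : submod H :=
  if s is x :: s' then killed_seq (killed N x) s' else N.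

Fixpoint divisible N (s : seq R) : Prop :=
  if s is x :: s' then
    (forall v, N v -> exists2 w, N w & x *: w = v) /\ divisible (killed N x) s'
  else True.

Variable M : submod R^o.
Hypothesis M1 : ~ M 1.
Hypothesis M_unit : forall r : R, ~ M r -> exists u : R, u * r = 1.
Hypothesis R_noeth : noeth (sfull : submod R^o) szero.
(** The form in which completeness enters: [s n] is the sum of the series x^i r(n+i). *)
Hypothesis M_complete : forall x : R, M x -> forall r : nat -> R,
  exists s : nat -> R, forall n, s n = r n + x * s n.+1.

(* Complete Nakayama: expanding f in powers of x and summing the coefficients *)
(* shows that generators of F modulo x F generate F.                          *)
Lemma noeth_complete (V : lmodType R) (F : submod V) (x : R) : M x ->
  (forall f : V, F f -> (forall n, exists2 g, F g & f = x ^+ n *: g) -> f = 0) ->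
  noeth F (smul x F) -> noeth F szero.
Proof.
move=> Mx sepF nF; have [g Fg] := noeth_sgen (@smul_le _ _ x F) nF.
have Fmem i : F g`_i.
  have [ig|gi] := ltnP i (size g); first by rewrite Fg; apply/sgen_mem/mem_nth.
  by rewrite nth_default //; apply: smem0.
have step (f : {f : V | F f}) : exists p : (nat -> R) * {f : V | F f},
    sval f = \sum_(i < size g) p.1 i *: g`_i + x *: sval p.2.
  case: f => f Ff /=; move: (Ff); rewrite {1}Fg => /sgen_sumP[_ [c [[f' Ff' ->] ->]]].
  by exists (c, exist _ f' Ff'); rewrite addrC.
have [nxt nxtP] := choice step.
suff -> : F = sgen szero g by apply: noeth_sgenS.
apply: submod_eqP => [f Ff|]; last first.
  apply: sgen_le; first exact: sle0.
  by move=> v /(nthP 0)[i _ <-]; apply: Fmem.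
pose u k := iter k (fun p => (nxt p).2) (exist _ f Ff).
have uE k : sval (u k) = \sum_(i < size g) (nxt (u k)).1 i *: g`_i + x *: sval (u k.+1).
  exact: nxtP.
have [s sP] := choice (fun i => M_complete Mx (fun k => (nxt (u k)).1 i)).
(* The error left after summing the coefficients satisfies h k = x h (k+1), so h 0 is divisible by
   all powers of [x] in [F] and vanishes. *)
pose h k := sval (u k) - \sum_(i < size g) s i k *: g`_i.
have Fh k : F (h k).
  apply: smemB; first exact: (svalP (u k)).
  by apply: smem_sum => i _; apply: smemZ; apply: Fmem.
have hS k : h k = x *: h k.+1.
  rewrite /h uE scalerBr scaler_sumr addrAC -sumrB addrC.
  congr (_ + _); rewrite -sumrN; apply: eq_bigr => i _.
  by rewrite sP scalerDl opprD addrA subrr sub0r scalerA.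
have h0 : h 0%N = 0.
  apply: sepF => // n; exists (h n) => //; elim: n => [|n IH].
    by rewrite expr0 scale1r.
  by rewrite IH hS scalerA -exprSr.
have /eqP := h0; rewrite subr_eq0 /= => /eqP ->.
by apply: smem_sum => i _; apply/smemZ/sgen_mem/mem_nth.
Qed.

Definition power_torsion N (x : R) : Prop := forall v, N v -> exists k, x ^+ k *: v = 0.

(** By induction Hom(N[x], T) is noetherian, hence so is its submodule Hom(N, T) modulo [x], and
    [noeth_complete] applies. Separatedness holds because every element of [N] is killed by a power
    of [x]. *)
Lemma noeth_homs N s : divisible N s -> (forall x, x \in s -> M x /\ power_torsion N x) ->
  noeth (homs (killed_seq N s)) szero -> noeth (homs N) szero.
Proof.
elim: s N => [|x s IH] N //= [Nx div_s] Ms nF.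
have [Mx Nnil] : M x /\ power_torsion N x by apply: Ms; rewrite inE eqxx.
have {IH} nF' : noeth (homs (killed N x)) szero.
  apply: IH => // y ys; have [|My Nny] := Ms y; first by rewrite inE ys orbT.
  by split=> // v [Nv _]; apply: Nny.
apply: (noeth_complete Mx).
  move=> f Nf fx; apply: (homs_eq0 Nf) => v Nv.
  have [k xkv] := Nnil v Nv; have [g [_ gZ _] ->] := fx k.
  by rewrite scalrfctE -gZ // xkv -(scale0r v) gZ // scale0r.
pose rho : {linear (H -> T) -> (H -> T)} := restr (killed N x).
move=> P PF [X0 PX0].
have ker : scap (homs N) (spre rho szero) <=s smul x (homs N) by apply: homs_restr_ker.
pose P' Y := exists2 X, P X & Y = push rho szero X.
have PX X : P X -> scap (homs N) (spre rho (push rho szero X)) = X.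
  move=> /PF[xX XF]; apply: push_pre => //; exact: sle_trans xX.
have [||Y [X PX1 EY] max] := nF' P'.
- move=> _ [X /PF[xX XF] ->]; split; first exact: sle0.
  apply: sadd_lub; last exact: sle0.
  by move=> _ [f /XF Nf ->]; apply: restr_homs Nf; apply: scap_lel.
- by exists (push rho szero X0), X0.
exists X => // Z PZ XZ.
rewrite -(PX X) // -(PX Z) // -EY (max (push rho szero Z)) //; first by exists Z.
by rewrite EY; apply: push_mono.
Qed.

Lemma annihilates_homs (J : submod R^o) N :
  annihilates J N szero -> annihilates J (homs N) szero.
Proof.
move=> JN c f Jc Nf; have Ncf : homs N ((c : R) *: f) by apply: smemZ.
apply: (homs_eq0 Ncf) => v Nv; have [_ fZ _] := Nf.
by rewrite scalrfctE -fZ // (JN c v) // -(scale0r v) fZ // scale0r.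
Qed.

(** As [x] is injective on F = Hom(N, T), the symbol of F equals that of F / xF over the remaining
    sequence. This quotient embeds in Hom(N[x], T), so additivity and nonnegativity give the bound
    by induction. *)
Lemma mult_homs (J : submod R^o) N s : divisible N s ->
  (forall x, x \in s -> M x /\ power_torsion N x) ->
  annihilates J N szero -> primary M (sgen J s) ->
  noeth (homs (killed_seq N s)) szero ->
  mult s (homs N) szero <= (len (homs (killed_seq N s)) szero)%:Z.
Proof.
elim: s J N => [|x s IH] J N // [Nx div_s] Ms JN primJ nF.
have Ms' y : y \in s -> M y /\ power_torsion (killed N x) y.
  move=> ys; have [|My Nny] := Ms y; first by rewrite inE ys orbT.
  by split=> // v [Nv _]; apply: Nny.
have JN' : annihilates (sadd J (scyc (x : R^o))) (killed N x) szero.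
  move=> _ v [j [_ [Jj [r _ ->] ->]]] [Nv xv]; rewrite scalerDl.
  apply: smemD; first exact: JN.
  have xv0 : x *: v = 0 by [].
  by change ((r * x) *: v = 0); rewrite -scalerA xv0 scaler0.
pose F := homs N; pose F' := homs (killed N x).
pose rho : {linear (H -> T) -> (H -> T)} := restr (killed N x).
have nF' : noeth F' szero by exact: (noeth_homs div_s Ms' nF).
rewrite mult_nzd; [|exact: sle0|exact: homs_nzd].
rewrite sadd0 -/F.
have ker : scap F (spre rho szero) <=s smul x F by apply: homs_restr_ker.
rewrite -(mult_push (f := rho) (D := szero) s (@smul_le _ _ _ _) ker).
have -> : push rho szero (smul x F) = szero.
  apply: submod_eqP; last exact: sle0.
  apply: sadd_lub => // _ [_ [f Ff ->] ->].
  apply/funext => v /=; rewrite /rho /= /homothety.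
  have [[Nv xv]|nv] := pselect (killed N x v); last by rewrite restr0.
  case: Ff => _ fZ _.
  have xv0 : x *: v = 0 by [].
  by rewrite restrE // scalrfctE -fZ // xv0 -(scale0r v) fZ // scale0r.
have PF' : push rho szero F <=s F'.
  apply: sadd_lub; last exact: sle0.
  by move=> _ [f Ff ->]; apply: restr_homs Ff; apply: scap_lel.
have okF' : mult_ok M (sadd J (scyc (x : R^o))) s F' szero.
  split=> //; first exact: sle0.
  exact: annihilates_homs.
apply: le_trans (IH _ _ div_s Ms' JN' primJ nF).
rewrite -/F' (mult_add M_unit R_noeth (@sle0 _ _ _) PF' okF') lerDr.
apply: (mult_ge0 M_unit R_noeth (J := sadd J (scyc (x : R^o)))).
by apply: mult_ok_sub okF' => //; apply: sle0.
Qed.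

Variable t0 : T.
Hypothesis t0_killed : forall y : R, M y -> y *: t0 = 0.
Hypothesis t0_socle : forall t : T, (forall y : R, M y -> y *: t = 0) ->
  exists c : R, t = c *: t0.

(** For a maximal proper submodule N' of [N], with N generated by N' and [a], the homomorphisms that
    vanish on N' are determined by their value at [a]. That value lies in the socle of [T], whose
    length is at most one. *)
Lemma chain_homs n N : (forall k, chain k N szero -> (k <= n)%N) ->
  forall k, chain k (homs N) szero -> (k <= n)%N.
Proof.
elim: n N => [|n IH] N bndN k cF.
  have N0 : N = szero.
    apply: contrapT => N0; have : (1 <= 0)%N; last by [].
    apply: bndN; exists szero; split; [exact: sle0| |exact: sle_refl].
    by move=> E; apply: N0.
  case: k cF => // k [C [CF CnF /chain_le C0]].
  case: CnF; apply: submod_eqP => // f Nf.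
  suff -> : f = 0 by apply: smem0.
  apply: (homs_eq0 Nf) => v; rewrite N0 => ->.
  by case: Nf => _ fZ _; rewrite -(scale0r (0 : H)) fZ ?scale0r //; apply: smem0.
have [N0|N0] := pselect (N = szero).
  apply: leq_trans (IH N _ k cF) (leqnSn n) => i; rewrite N0.
  by case: i => // i [C [C0 Cn0 /chain_le C0']]; case: Cn0; apply: submod_eqP.
have nN : noeth N szero by apply: finlen_noeth; exists n.+1.
have [||N' [N'N N'nN] max] := nN (fun C => C <=s N /\ C <> N).
- by move=> C [CN _]; split=> //; apply: sle0.
- by exists szero; split; [apply: sle0|move=> E; apply: N0].
have [a /not_implyP[Na nN'a]] : exists a, ~ (N a -> N' a).
  by apply/existsNP => NN'; apply: N'nN; apply: submod_eqP.
have NN' : sadd N' (scyc a) = N.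
  apply: contrapT => nE; apply: nN'a; rewrite -(max (sadd N' (scyc a))).
  - by apply: sle_addr; apply: scyc_id.
  - by split=> //; apply: sadd_lub => //; apply: scyc_le.
  - exact: sle_addl.
(* Nakayama: otherwise a = b + c y a with b in N', and 1 - c y is a unit. *)
have Ma (y : R) : M y -> N' (y *: a).
  move=> My; apply: contrapT => nya.
  have NN2 : sadd N' (scyc (y *: a)) = N.
    apply: contrapT => nE; apply: nya; rewrite -(max (sadd N' (scyc (y *: a)))).
    - by apply: sle_addr; apply: scyc_id.
    - by split=> //; apply: sadd_lub => //; apply/scyc_le/smemZ.
    - exact: sle_addl.
  have : sadd N' (scyc (y *: a)) a by rewrite NN2.
  case=> b [_ [N'b [c _ ->] /= Ea]].
  have [|u uE] := M_unit (r := 1 - c * y).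
    move=> M1'; apply: M1; rewrite -(subrK (c * y) 1); apply: smemD => //.
    exact: (@smemZ _ _ M).
  apply: nN'a; rewrite -(scale1r a) -uE -scalerA; apply: smemZ.
  by rewrite scalerBl scale1r {1}Ea /orbit_map scalerA addrK.
pose rho : {linear (H -> T) -> (H -> T)} := restr N'.
pose K := scap (homs N) (spre rho szero).
have [p [q [kpq cp cq]]] := chain_split (sle0 K) cF.
have KF : K <=s homs N by apply: scap_lel.
have pn : (p <= n)%N.
  apply: (IH N').
    move=> i ci; rewrite -ltnS; apply: bndN; exists N'; split=> //.
  move: cp; rewrite (sadd_idr KF) => /(chain_push (f := rho) (D := szero) KF (@sle_refl _ _ _)).
  apply: chain_mono; last exact: sle_trans (@push_geD _ _ _ _ _ _).
  apply: sadd_lub; last exact: sle0.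
  by move=> _ [f Ff ->]; apply: restr_homs Ff.
have q1 : (q <= 1)%N.
  have {}cq : chain q K szero by apply: chain_mono cq => //; apply: scap_ler.
  have ker : scap K (spre (eval_at a) szero) <=s szero.
    move=> f [[Nf /= f0] /= fa]; apply: (homs_eq0 Nf) => v.
    rewrite -NN' => -[b [_ [N'b [c _ ->] ->]]] /=; rewrite /orbit_map.
    have [fD fZ _] := Nf.
    rewrite fD ?fZ //; [|exact: N'N|exact: smemZ].
    have -> : f a = 0 by [].
    by rewrite scaler0 addr0 -(restrE f N'b) f0.
  apply: (@chain_simple _ M M_unit T q szero t0); first by move=> y /t0_killed.
  move: cq => /(chain_push (f := eval_at a) (D := szero) (sle0 K) ker).
  apply: chain_mono; last exact: sle0.
  apply: sadd_lub => [_ [f [Nf f0] ->]|]; last exact: sle0.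
  apply: sle_addr; have [fD fZ _] := Nf.
  have [|c t0c] := t0_socle (t := f a); last by exists c => //; exact: t0c.
  move=> y My; have rf0 : restr N' f = 0 by [].
  by rewrite -fZ // -(restrE f (Ma y My)) rf0.
apply: leq_trans kpq _; rewrite -addn1; exact: leq_add.
Qed.

(** The kernel hypothesis says that r |-> r psi embeds R in Hom(N, T). The bound is then e(s; R) <=
    e(s; Hom(N, T)) <= length Hom(N[s], T) <= length N[s]. *)
Lemma len_regular_le N s (psi : {linear H -> T}) :
  divisible N s -> (forall x, x \in s -> M x /\ power_torsion N x) ->
  primary M (sgen (szero : submod R^o) s) -> regular (szero : submod R^o) s ->
  finlen (killed_seq N s) szero ->
  (forall r : R, (forall v, N v -> psi (r *: v) = 0) -> r = 0) ->
  (len (sfull : submod R^o) (sgen (szero : submod R^o) s) <= len (killed_seq N s) szero)%N.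
Proof.
move=> div_s Ms prim reg_s finN psi0.
pose f0 : H -> T := restr N psi.
have Nf0 : homs N f0 by apply: linear_homs.
have [cN maxN] := lenP (sle0 (killed_seq N s)) finN.
have bndF := chain_homs maxN.
have finF : finlen (homs (killed_seq N s)) szero by exists (len (killed_seq N s) szero).
have nF' := finlen_noeth finF.
have nF : noeth (homs N) szero by apply: noeth_homs nF'.
have ann0 (V : lmodType R) (A : submod V) : annihilates szero A szero.
  by move=> c v -> _; rewrite scale0r.
have okF : mult_ok M szero s (homs N) szero by split=> //; apply: sle0.
have ker : scap sfull (spre (orbit_map f0) szero) <=s szero.
  move=> r [_ /= rf0]; apply: psi0 => v Nv.
  rewrite linearZ /= -(restrE psi Nv) -/f0.
  by have := congr1 (fun g => g v) rf0.
pose P := push (orbit_map f0) szero sfull.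
have PF : P <=s homs N.
  by apply: sadd_lub; [exact: scyc_le|exact: sle0].
rewrite -lez_nat -mult_regular //.
rewrite -(mult_push (f := orbit_map f0) (D := szero) s (sle0 _) ker).
have -> : push (orbit_map f0) szero szero = szero.
  apply: submod_eqP; last exact: sle0.
  by apply: sadd_lub => // _ [_ -> ->]; rewrite linear0.
apply: (@le_trans _ _ (mult s (homs N) szero)).
  rewrite (mult_add M_unit R_noeth (sle0 P) PF okF) lerDr.
  apply: (mult_ge0 M_unit R_noeth (J := szero)).
  by apply: mult_ok_sub okF => //; apply: sle0.
apply: le_trans (mult_homs div_s Ms (ann0 _ _) prim nF') _.
rewrite lez_nat.
by have [c _] := lenP (sle0 (homs (killed_seq N s))) finF; apply: bndF.
Qed.

End Hom.

(** * Prime ideals and systems of parameters *)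

Section Ideals.
Variable R : comNzRingType.
Implicit Types (J : submod R^o) (a b r x y : R).

Lemma smemMl J a b : J b -> J (a * b).
Proof. exact: (smemZ (s := J)). Qed.
Lemma smemMr J a b : J a -> J (a * b).
Proof. by rewrite mulrC; apply: smemMl. Qed.

Definition prime_ideal J : Prop := ~ J 1 /\ forall a b, J (a * b) -> J a \/ J b.

Section OfSubmod.
Variables (J : submod R^o) (J1 : ~ J 1).

(** Properness is an argument of the predicate so that the [idealr] structure can be attached to
    it. *)
Definition ideal_mem (_ : ~ J 1) (a : R) : bool := `[< J a >].

Fact ideal_mem_closed : idealr_closed (ideal_mem J1).
Proof.
split.
- by apply/asboolP; apply: (@smem0 _ _ J).
- by apply/negP => /asboolP.
- move=> a u v /asboolP Ju /asboolP Jv; apply/asboolP.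
  by apply: smemD => //; apply: smemMl.
Qed.

HB.instance Definition _ := isIdealr.Build R (ideal_mem J1) ideal_mem_closed.

Definition idealr_of : idealr R := Idealr.clone R (ideal_mem J1) _.

End OfSubmod.

Section PrimeOfSubmod.
Variables (J : submod R^o) (Jp : prime_ideal J).

Definition prime_mem : R -> bool := ideal_mem Jp.1.

HB.instance Definition _ := Idealr.copy prime_mem (ideal_mem Jp.1).

Fact prime_mem_closed : prime_idealr_closed prime_mem.
Proof.
move=> a b /asboolP/(Jp.2)[Ja|Jb]; apply/orP; [left|right]; exact/asboolP.
Qed.

HB.instance Definition _ := isPrimeIdealrClosed.Build R prime_mem prime_mem_closed.

Definition prime_idealr_of : prime_idealr R := PrimeIdealr.clone R prime_mem _.

End PrimeOfSubmod.

Definition of_idealr (m : idealr R) : submod R^o.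
Proof.
exists (fun a : R^o => (a : R) \in m).
- exact: idealr0.
- by move=> u v mu mv; apply: rpredD.
- by move=> a v mv; apply: idealMr.
Defined.

Definition pchain n (F : nat -> submod R^o) : Prop :=
  (forall i, (i <= n)%N -> prime_ideal (F i)) /\
  (forall i, (i < n)%N -> F i <=s F i.+1 /\ F i <> F i.+1).

Lemma pchain_cons n F P : prime_ideal P -> P <=s F 0%N -> P <> F 0%N -> pchain n F ->
  pchain n.+1 (fun i => if i is k.+1 then F k else P).
Proof. by move=> pP PF PnF [pF sF]; split=> [[|i]|[|i]] //=; [apply: pF|apply: sF]. Qed.

Lemma pchain_rcons n F P : prime_ideal P -> F n <=s P -> F n <> P -> pchain n F ->
  pchain n.+1 (fun i => if (i <= n)%N then F i else P).
Proof.
move=> pP FP FnP [pF sF]; split=> i; first by case: ifP => // lein _; apply: pF.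
rewrite ltnS => lein; rewrite lein; case: ltnP => [|leni]; first exact: sF.
by have -> : i = n by apply/eqP; rewrite eqn_leq lein.
Qed.

Lemma pchain_le d n F : krull_dim R d -> pchain n F -> (n <= d)%N.
Proof.
case=> _ maxd [pF sF].
have pF' (i : 'I_n.+1) : prime_ideal (F i) by apply: pF; rewrite -ltnS.
apply: (maxd n (fun i => prime_idealr_of (pF' i))) => i j ij.
have Fmono k l : (k <= l)%N -> (l <= n)%N -> F k <=s F l.
  move/subnK <-; elim: (l - k)%N => [|p IH] pk //.
  by case: (sF (p + k)%N pk) => sFp _; apply: sle_trans sFp; apply/IH/ltnW.
have ltin : (i < n)%N by apply: leq_trans ij _; rewrite -ltnS.
have leij : F i.+1 <=s F j by apply: Fmono => //; rewrite -ltnS.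
have [sFi nFi] := sF i ltin.
split=> [a /asboolP Fa|]; first exact/asboolP/leij/sFi.
have [a /not_implyP[Fja nFia]] : exists a, ~ (F j a -> F i a).
  apply/existsNP => FjFi; apply: nFi; apply: submod_eqP => // a Fa.
  by apply: FjFi; apply: leij.
by exists a; [apply/asboolP|apply/negP => /asboolP].
Qed.

Hypothesis R_noeth : noeth (sfull : submod R^o) szero.

Lemma noeth_max (P : submod R^o -> Prop) J0 : P J0 ->
  exists J, [/\ P J, J0 <=s J & forall J', P J' -> J <=s J' -> J' = J].
Proof.
move=> PJ0.
have [||J [PJ J0J] max] := R_noeth (P := fun J => P J /\ J0 <=s J).
- by move=> J _; split=> //; apply: sle0.
- by exists J0; split.
exists J; split=> // J' PJ' JJ'; apply: max => //; split=> //.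
exact: sle_trans JJ'.
Qed.

Lemma sadd_scycP J a b : sadd J (scyc (a : R^o)) b -> exists j r, J j /\ b = j + r * a.
Proof. by case=> j [_ [Jj [r _ ->] ->]]; exists j, r. Qed.

(** Krull: an ideal maximal among those disjoint from a multiplicative set is prime. *)
Lemma prime_avoiding J (S : R -> Prop) : S 1 ->
  (forall a b, S a -> S b -> S (a * b)) -> (forall a, J a -> ~ S a) ->
  exists P, [/\ prime_ideal P, J <=s P & forall a, P a -> ~ S a].
Proof.
move=> S1 SM JS.
have [P [PS JP max]] := @noeth_max (fun J => forall a, J a -> ~ S a) J JS.
exists P; split=> //; split; first by move=> /PS.
have big a : ~ P a -> exists j r, P j /\ S (j + r * a).
  move=> nPa; apply: contrapT => nS; apply: nPa.
  rewrite -(max (sadd P (scyc (a : R^o)))); last exact: sle_addl.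
    by apply: sle_addr; apply: scyc_id.
  move=> _ /sadd_scycP[j [r [Pj ->]]] Sj; apply: nS; by exists j, r.
move=> a b Pab; apply: contrapT => /not_orP[/big[i [r [Pi Si]]] /big[j [s [Pj Sj]]]].
apply: (PS _ _ (SM _ _ Si Sj)).
have -> : (i + r * a) * (j + s * b) = (j + s * b) * i + r * a * j + r * s * (a * b).
  by ring.
by apply: smemD; [apply: smemD|]; apply: smemMl.
Qed.

(** Noetherian induction: if ab lies in [J] but [a] and [b] do not, every prime above [J] contains J
    + (a) or J + (b). The list may also contain primes that are not minimal. *)
Lemma minimal_primes J : exists Ps : seq (submod R^o),
  (forall P, List.In P Ps -> prime_ideal P /\ J <=s P) /\
  (forall Q, prime_ideal Q -> J <=s Q -> exists2 P, List.In P Ps & P <=s Q).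
Proof.
apply: contrapT => nJ.
have [J' [{}nJ _ max]] := @noeth_max (fun J => ~ _) J nJ.
have [J1|J1] := pselect (J' 1).
  apply: nJ; exists [::]; split=> // Q [Q1 _] JQ; by case: Q1; apply: JQ.
have [pJ|npJ] := pselect (prime_ideal J').
  apply: nJ; exists [:: J']; split=> [P [<-|[]]|Q _ JQ]; first by split.
  by exists J'; first left.
have {npJ} [a [b [Jab nJa nJb]]] : exists a b, [/\ J' (a * b), ~ J' a & ~ J' b].
  apply: contrapT => nab; apply: npJ; split=> // a b Jab.
  apply: contrapT => /not_orP[nJa nJb]; by apply: nab; exists a, b.
have bigger c : ~ J' c -> exists Ps : seq (submod R^o),
    (forall P, List.In P Ps -> prime_ideal P /\ sadd J' (scyc (c : R^o)) <=s P) /\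
    (forall Q, prime_ideal Q -> sadd J' (scyc (c : R^o)) <=s Q ->
       exists2 P, List.In P Ps & P <=s Q).
  move=> nJc; apply: contrapT => nc; apply: nJc.
  rewrite -(max _ nc); last exact: sle_addl.
  by apply: sle_addr; apply: scyc_id.
have [[Pa [Pa1 Pa2]] [Pb [Pb1 Pb2]]] := (bigger a nJa, bigger b nJb).
apply: nJ; exists (Pa ++ Pb); split=> [P|Q pQ JQ].
  move=> /(@List.in_app_or _ _ _ _)[/Pa1|/Pb1] [pP sP]; split=> //.
    by apply: sle_trans sP; apply: sle_addl.
  by apply: sle_trans sP; apply: sle_addl.
have [Qa|Qb] := pQ.2 a b (JQ _ Jab).
  have [|P PPa PQ] := Pa2 Q pQ; first by apply: sadd_lub => //; apply: scyc_le.
  by exists P => //; apply/List.in_or_app; left.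
have [|P PPb PQ] := Pb2 Q pQ; first by apply: sadd_lub => //; apply: scyc_le.
by exists P => //; apply/List.in_or_app; right.
Qed.

Lemma prime_avoidance J (Ps : seq (submod R^o)) :
  (forall P, List.In P Ps -> prime_ideal P /\ ~ (J <=s P)) ->
  exists2 y, J y & forall P, List.In P Ps -> ~ P y.
Proof.
have [n] := ubnP (size Ps); elim: n Ps => // n IH [|P Ps] /= szn PsJ.
  by exists 0 => //; apply: smem0.
have [pP nJP] := PsJ P (or_introl erefl).
(* The primes inside [P] are avoided together with [P]. The others have elements outside [P]; a
   product of these with an element of [J] outside [P] corrects [y] when [y] falls in [P]. *)
pose Qs := [seq Q <- Ps | `[< ~ (Q <=s P) >]].
have QsP Q : List.In Q Qs -> List.In Q Ps /\ ~ (Q <=s P).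
  by rewrite /Qs; elim: (Ps) => //= Q' t IHt; case: ifP => [/asboolP ? [<-|]|_] //;
    [split=> //; left|move=> /IHt[? ?]; split=> //; right|move=> /IHt[? ?]; split=> //; right].
have PsQ Q : List.In Q Ps -> ~ (Q <=s P) -> List.In Q Qs.
  rewrite /Qs; elim: (Ps) => //= Q' t IHt [->|Qt] nQP; first by rewrite asboolT //; left.
  by case: ifP => _; [right|]; apply: IHt.
have [|Q /QsP[QPs _]|y Jy Qsy] := IH Qs.
- by rewrite size_filter (leq_ltn_trans (count_size _ _)).
- by apply: PsJ; right.
suff [z [Jz Pz Qsz]] : exists z, [/\ J z, ~ P z & forall Q, List.In Q Qs -> ~ Q z].
  exists z => // Q [<-//|QPs] Qz.
  have [QP|nQP] := pselect (Q <=s P); first exact/Pz/QP.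
  exact: (Qsz Q (PsQ Q QPs nQP)).
have [Py|nPy] := pselect (P y); last by exists y.
have [w [Jw nPw]] : exists w, J w /\ ~ P w.
  by apply: contrapT => nw; apply: nJP => w Jw; apply: contrapT => nPw; apply: nw; exists w.
have [z [nPz Jz Qsz]] : exists z, [/\ ~ P z, J z & forall Q, List.In Q Qs -> Q z].
  have : forall Q, List.In Q Qs -> ~ (Q <=s P) by move=> Q /QsP[].
  elim: (Qs) => [|Q t IHt] QtP; first by exists w.
  have [|z [nPz Jz tz]] := IHt; first by move=> Q' tQ'; apply: QtP; right.
  have [u [Qu nPu]] : exists u, Q u /\ ~ P u.
    apply: contrapT => nu; apply: (QtP Q (or_introl erefl)) => u Qu.
    by apply: contrapT => nPu; apply: nu; exists u.
  exists (u * z); split.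
  - by case/pP.2.
  - exact: smemMl.
  - by move=> Q' [<-|/tz Qz]; [apply: smemMr|apply: smemMl].
exists (y + z); split.
- exact: smemD.
- by move=> Pyz; apply: nPz; apply: (@smem_addl _ _ _ _ y) => //; rewrite addrC.
- by move=> Q QQs Qyz; apply: (Qsy Q QQs); apply: (@smem_addl _ _ _ _ z) => //; apply: Qsz.
Qed.

Variable M : submod R^o.
Hypothesis M1 : ~ M 1.
Hypothesis M_unit : forall r : R, ~ M r -> exists u : R, u * r = 1.

Lemma proper_le J : ~ J 1 -> J <=s M.
Proof.
move=> J1 a Ja; apply: contrapT => /M_unit[u ua]; apply: J1.
by rewrite -ua; apply: smemMl.
Qed.

Lemma prime_M : prime_ideal M.
Proof.
split=> // a b Mab; apply: contrapT => /not_orP[/M_unit[u ua] /M_unit[v vb]].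
apply: M1; rewrite -[1]mulr1 -{1}ua -vb mulrACA; exact: smemMl.
Qed.

Lemma prime_pow P a k : prime_ideal P -> P (a ^+ k) -> P a.
Proof.
move=> [P1 pP]; elim: k => [|k IH]; first by rewrite expr0.
by rewrite exprS => /pP[].
Qed.

(** If no power of [y] lies in [J], some prime above [J] avoids all of them. *)
Lemma primaryP J : primary M J <-> forall P, prime_ideal P -> J <=s P -> M <=s P.
Proof.
split=> [primJ P pP JP y My|MP y My].
  by have [k /JP] := primJ y My; apply: prime_pow.
apply: contrapT => ny.
have [|||P [pP JP Py]] := @prime_avoiding J (fun a => exists k, a = y ^+ k).
- by exists 0%N; rewrite expr0.
- by move=> _ _ [k ->] [l ->]; exists (k + l)%N; rewrite exprD.
- by move=> a Ja [k Ea]; apply: ny; exists k; rewrite -Ea.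
apply: (Py y); last by exists 1%N; rewrite expr1.
exact: MP.
Qed.

(** In spite of the name this bounds the dimension of R / J: only chains of primes above [J]
    count. *)
Definition codim_le n J : Prop := forall k F, pchain k F -> J <=s F 0%N -> (k <= n)%N.

(** An element of [M] outside the primes of [minimal_primes] that do not contain [M] lowers the
    dimension of R / J by one. *)
Lemma codim_primary n J : codim_le n J -> J <=s M ->
  exists s : seq R, [/\ size s = n, forall x, x \in s -> M x & primary M (sgen J s)].
Proof.
elim: n J => [|n IH] J cJ JM.
  exists [::]; split=> //=; apply/primaryP => P pP JP; apply: contrapT => nMP.
  have c0 : pchain 0 (fun=> P) by split.
  have cPM : pchain 1 (fun i => if (i <= 0)%N then P else M).
    apply: (pchain_rcons prime_M _ _ c0); first exact/proper_le/pP.1.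
    by move=> E; apply: nMP; rewrite E.
  by have := cJ _ _ cPM JP.
have [Ps [PsJ Psmin]] := minimal_primes J.
pose Qs := [seq P <- Ps | `[< ~ (M <=s P) >]].
have QsP Q : List.In Q Qs <-> List.In Q Ps /\ ~ (M <=s Q).
  rewrite /Qs; elim: (Ps) => [|Q' t IHt] /=; first by split=> // -[].
  have [MQ'|nMQ'] := pselect (M <=s Q').
    rewrite asboolF //; split=> [/IHt[? ?]|[[<-|? ?]]] //; first by split=> //; right.
    exact/IHt.
  rewrite asboolT //=; split=> [[<-|/IHt[? ?]]|[[->|?] ?]].
  - by split=> //; left.
  - by split=> //; right.
  - by left.
  - by right; apply/IHt.
have [Q /QsP[QPs nMQ]|y My Qsy] := @prime_avoidance M Qs.
  by split=> //; case: (PsJ Q QPs).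
have [||s [szs Ms prim]] := IH (sadd J (scyc (y : R^o))).
(* A chain above J + (y) extends downwards by a prime of the list: that prime omits [y], or else it
   contains [M] and the chain has length 0. *)
- move=> k F cF JF.
  have pF : prime_ideal (F 0%N) by apply: cF.1.
  have [|P PPs PF] := Psmin _ pF; first by apply: sle_trans JF; apply: sle_addl.
  have [MP|nMP] := pselect (M <=s P).
    case: k cF => // k [pF' sF]; have [FF nFF] := sF 0%N isT.
    case: nFF; apply: submod_eqP => //; apply: sle_trans (sle_trans MP PF).
    by apply: proper_le; case: (pF' 1%N isT).
  have nPF : P <> F 0%N.
    move=> E; apply: (Qsy P); first exact/QsP.
    by rewrite E; apply: JF; apply: sle_addr; apply: scyc_id.
  have := cJ _ _ (pchain_cons (PsJ P PPs).1 PF nPF cF).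
  by rewrite ltnS; apply; case: (PsJ P PPs).
- by apply: sadd_lub => //; apply: scyc_le.
by exists (y :: s); split=> //=; [rewrite szs|move=> x; rewrite inE => /orP[/eqP ->|/Ms]].
Qed.

(** * Regular sequences *)

Lemma regular_cat J s t : regular J (s ++ t) <-> regular J s /\ regular (sgen J s) t.
Proof.
elim: s J => [|x s IH] J /=; first by split=> [|[]].
by rewrite IH; split=> [[? []]|[[]]].
Qed.

(** For the regularity of [b], take k outside J with bk in J and J + (k) maximal. Modulo J one gets
    k = a k' with b k' in J, so maximality puts k' in J + (a k'), and 1 - ra being a unit forces k'
    into J. *)
Lemma regular_swap J a b s : M a -> regular J [:: a, b & s] -> regular J [:: b, a & s].
Proof.
move=> Ma [Ja [Jb reg_s]].
have EJ : sadd (sadd J (scyc (b : R^o))) (scyc (a : R^o)) =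
          sadd (sadd J (scyc (a : R^o))) (scyc (b : R^o)).
  apply: submod_eqP; apply: sadd_lub.
  - by apply: sadd_mono => //; apply: sle_addl.
  - by apply: sle_trans (@sle_addl _ _ _ _); apply: sle_addr.
  - by apply: sadd_mono => //; apply: sle_addl.
  - by apply: sle_trans (@sle_addl _ _ _ _); apply: sle_addr.
split; last split; last by rewrite EJ.
- move=> c Jbc; apply: contrapT => nJc.
  pose P I := exists k, [/\ J (b * k), ~ J k & I = sadd J (scyc (k : R^o))].
  have [|I [[k [Jbk nJk EI]] _ max]] := @noeth_max P (sadd J (scyc (c : R^o))).
    by exists c.
  have [|j [k' [Jj Ek]]] := @sadd_scycP J a k.
    by apply: Jb; apply: sle_addl.
  have Jbk' : J (b * k').
    apply: Ja; rewrite (_ : a * (b * k') = b * k - b * j).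
      by apply: smemB => //; apply: smemMl.
    by rewrite Ek; ring.
  have nJk' : ~ J k' by move=> Jk'; apply: nJk; rewrite Ek; apply: smemD => //; apply: smemMr.
  have : I k'.
    rewrite -(max (sadd J (scyc (k' : R^o)))); first exact/sle_addr/scyc_id.
    - by exists k'.
    - rewrite EI; apply: sadd_lub; first exact: sle_addl.
      apply: scyc_le; rewrite Ek [k' * a]mulrC; apply: smemD; first exact: sle_addl.
      by apply: sle_addr; exists a.
  rewrite EI => /sadd_scycP[j' [r [Jj' Ek']]].
  have [|u uE] := M_unit (r := 1 - r * a).
    move=> Mra; apply: M1; rewrite -(subrK (r * a) 1); apply: smemD => //.
    exact: smemMl.
  apply: nJk'; rewrite -(mul1r k') -uE -mulrA; apply: smemMl.
  rewrite (_ : (1 - r * a) * k' = j' + r * j); first by apply: smemD => //; apply: smemMl.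
  by rewrite mulrBl mul1r {1}Ek' Ek; ring.
- move=> c /sadd_scycP[j [t [Jj Eac]]].
  have [|i [t' [Ji Et]]] := @sadd_scycP J a t.
    apply: Jb; exists (- j), (c * a); split; [exact: smemN|by exists c|].
    by rewrite [c * a]mulrC Eac; ring.
  exists (c - t' * b), (t' * b); split; [|by exists t'|by rewrite subrK].
  apply: Ja; rewrite mulrBr Eac Et.
  rewrite (_ : _ - _ = j + b * i); first by apply: smemD => //; apply: smemMl.
  by ring.
Qed.

Lemma regular_rot J a s : M a -> (forall x, x \in s -> M x) ->
  regular J (a :: s) <-> regular J (s ++ [:: a]).
Proof.
move=> Ma; elim: s J => [|b s IH] J Ms; first by [].
have {}IH J' : regular J' (a :: s) <-> regular J' (s ++ [:: a]).
  by apply: IH => x xs; apply: Ms; rewrite inE xs orbT.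
have Mb : M b by apply: Ms; rewrite inE eqxx.
split=> [/(regular_swap Ma)[Jb /IH]|[Jb /IH reg_s]]; first by [].
exact: (@regular_swap J b a).
Qed.

(** After rotation [x] comes last, where passing to a power is immediate. *)
Lemma regular_exp J x n s : M x -> (forall y, y \in s -> M y) ->
  regular J (x :: s) -> regular J (x ^+ n.+1 :: s).
Proof.
move=> Mx Ms; rewrite !regular_rot //; last by rewrite exprS; apply: smemMr.
rewrite !regular_cat => -[? [Jx _]]; split=> //; split=> // a.
elim: n.+1 => [|k IH]; first by rewrite expr0 mul1r.
by rewrite exprS -mulrA => /Jx.
Qed.

Lemma regular_powers J n s : (forall y, y \in s -> M y) ->
  regular J s -> regular J [seq x ^+ n.+1 | x <- s].
Proof.
elim: s J => [|x s IH] J Ms // reg_s.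
have Mx : M x by apply: Ms; rewrite inE eqxx.
have Ms' y : y \in s -> M y by move=> ys; apply: Ms; rewrite inE ys orbT.
have [Jx reg_s'] := regular_exp n Mx Ms' reg_s.
by split=> //; apply: IH.
Qed.

Lemma regular_head_powers J n x s : M x -> (forall y, y \in s -> M y) ->
  regular J (x :: s) -> forall a, sgen J [seq y ^+ n.+1 | y <- s] (x * a) ->
  sgen J [seq y ^+ n.+1 | y <- s] a.
Proof.
move=> Mx Ms [Jx reg_s].
have : regular J (x :: [seq y ^+ n.+1 | y <- s]) by split=> //; apply: regular_powers.
rewrite regular_rot // => [/regular_cat[_ []] //|_ /mapP[y /Ms My ->]].
by rewrite exprS; apply: smemMr.
Qed.

(** Given a chain for the tail starting at F 0, the set of all x^k t with t outside F 0 misses [J],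
    because [x] is regular modulo [J]. A prime above [J] avoiding this set lies strictly below F
    0. *)
Lemma regular_height J s P : regular J s -> prime_ideal P -> sgen J s <=s P ->
  exists F, [/\ pchain (size s) F, F (size s) = P & J <=s F 0%N].
Proof.
elim: s J => [|x s IH] J /=; first by move=> _ pP JP; exists (fun=> P).
move=> [Jx reg_s] pP sP; have [F [cF FP JF]] := IH _ reg_s pP sP.
have pF : prime_ideal (F 0%N) by apply: cF.1.
pose S a := exists k t, ~ F 0%N t /\ a = x ^+ k * t.
have [||a Ja|Q [pQ JQ QS]] := @prime_avoiding J S.
- by exists 0%N, 1; split; [case: pF|rewrite expr0 mulr1].
- move=> _ _ [k [t [nt ->]]] [l [u [nu ->]]]; exists (k + l)%N, (t * u).
  by split; [case/pF.2|rewrite exprD mulrACA].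
- case=> k [t [nt Ea]]; apply: nt; apply: JF; apply: sle_addl.
  move: Ja; rewrite Ea; elim: k {Ea} => [|k IHk]; first by rewrite expr0 mul1r.
  by rewrite exprS -mulrA => /Jx.
exists (fun i => if i is k.+1 then F k else Q); split=> //.
apply: pchain_cons => //.
- move=> a Qa; apply: contrapT => nFa; apply: (QS a Qa).
  by exists 0%N, a; rewrite expr0 mul1r.
- move=> E; apply: (QS x); last by exists 1%N, 1; split; [case: pF|rewrite expr1 mulr1].
  by rewrite E; apply: JF; apply: sle_addr; apply: scyc_id.
Qed.

(** A prime above the sequence that does not contain [M] would top a chain of length d, and adding
    [M] would exceed the dimension. *)
Lemma regular_primary d s : krull_dim R d -> regular (szero : submod R^o) s ->
  (forall x, x \in s -> M x) -> size s = d -> primary M (sgen (szero : submod R^o) s).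
Proof.
move=> dimR reg_s Ms szs; apply/primaryP => P pP sP; apply: contrapT => nMP.
have [F [cF FP _]] := regular_height reg_s pP sP.
have FM : F (size s) <=s M by rewrite FP; apply/proper_le/pP.1.
have nFM : F (size s) <> M by rewrite FP => E; apply: nMP; rewrite E.
by have := pchain_le dimR (pchain_rcons prime_M FM nFM cF); rewrite szs ltnn.
Qed.

Lemma regular_sequence_regular s : regular_sequence s -> regular (szero : submod R^o) s.
Proof.
case=> reg_s _.
suff gen (p t : seq R) : s = p ++ t -> regular (sgen (szero : submod R^o) p) t.
  exact: (gen [::] s erefl).
elim: t p => // x t IH p Es; split.
  move=> a /ideal_genP; have := reg_s (size p) a.
  rewrite Es size_cat /= addnS ltnS leq_addr nth_cat ltnn subnn take_size_cat //=.
  by move=> /(_ isT) reg /reg /ideal_genP.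
rewrite -[sadd _ _]/(sgen (sgen (szero : submod R^o) p) [:: (x : R^o)]) -sgen_cat.
by apply: IH; rewrite Es -catA.
Qed.

End Ideals.

(** In a domain the zero ideal extends every chain of primes containing r, so R / r has dimension at
    most d - 1 and [codim_primary] supplies the other parameters. *)
Lemma parameter_extends (R : idomainType) (M : submod R^o) d (r : R) :
  noeth (sfull : submod R^o) szero -> ~ M 1 ->
  (forall a : R, ~ M a -> exists u : R, u * a = 1) ->
  krull_dim R d -> M r -> r != 0 ->
  exists s : seq R, [/\ size (r :: s) = d, forall x, x \in r :: s -> M x
    & primary M (sgen (szero : submod R^o) (r :: s))].
Proof.
move=> R_noeth M1 M_unit dimR Mr r0.
have p0 : prime_ideal (szero : submod R^o).
  split; first by move=> /= /eqP; rewrite oner_eq0.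
  by move=> a b /= /eqP; rewrite mulf_eq0 => /orP[/eqP ->|/eqP ->]; [left|right].
have ext k F : pchain k F -> F 0%N r -> (k < d)%N.
  move=> cF Fr; apply: (pchain_le dimR (pchain_cons p0 (@sle0 _ _ _) _ cF)).
  by move=> E; move: Fr; rewrite -E => /= /eqP; apply/negP.
case: d dimR ext => [|d] dimR ext.
  have cM : pchain 0 (fun=> M) by split=> // i _; apply: prime_M.
  by have := ext _ _ cM Mr.
have [||s [szs Ms prim]] := @codim_primary R R_noeth M M1 M_unit d (scyc (r : R^o)).
- by move=> k F cF rF; rewrite -ltnS; apply: ext cF _; apply/rF/scyc_id.
- exact: scyc_le.
exists s; split=> /=; first by rewrite szs.
- by move=> x; rewrite inE => /orP[/eqP ->|/Ms].
- by rewrite (sadd_idl (@sle0 _ _ _)).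
Qed.

(** * Powers of an ideal *)

Section IdealPowers.
Variables (R : comNzRingType) (m : idealr R).

Lemma ideal_expD k a b :
  a \in ideal_exp m k -> b \in ideal_exp m k -> a + b \in ideal_exp m k.
Proof.
move=> /asboolP[p [c [t [tm ->]]]] /asboolP[q [c' [t' [tm' ->]]]].
apply/asboolP; exists (p + q)%N.
exists (fun i => match fintype.split i with inl j => c j | inr j => c' j end).
exists (fun i => match fintype.split i with inl j => t j | inr j => t' j end).
split=> [i|]; first by case: (fintype.split i).
rewrite big_split_ord /=; congr (_ + _); apply: eq_bigr => i _.
  by rewrite -[lshift _ _]/(unsplit (inl i)) unsplitK.
by rewrite -[rshift _ _]/(unsplit (inr i)) unsplitK.
Qed.

Lemma ideal_expMl k a b : b \in ideal_exp m k -> a * b \in ideal_exp m k.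
Proof.
move=> /asboolP[p [c [t [tm ->]]]]; apply/asboolP; exists p, (fun i => a * c i), t.
by split=> //; rewrite mulr_sumr; apply: eq_bigr => i _; rewrite mulrA.
Qed.

Lemma ideal_expX k x : x \in m -> x ^+ k \in ideal_exp m k.
Proof.
move=> mx; apply/asboolP; exists 1%N, (fun=> 1), (fun=> [tuple of nseq k x]).
split=> [_ y|]; first by rewrite mem_nseq => /andP[_ /eqP ->].
rewrite big_ord1 mul1r /=; elim: k => [|k IH]; first by rewrite big_nil.
by rewrite /= big_cons -IH exprS.
Qed.

(** The limits of the partial sums satisfy the recursion modulo every power of m, hence exactly. *)
Lemma complete_series : adically_complete m -> forall x, x \in m ->
  forall r : nat -> R, exists s : nat -> R, forall n, s n = r n + x * s n.+1.
Proof.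
case=> sep compl x mx r.
pose u n k := \sum_(i < k) x ^+ i * r (n + i)%N.
have ulim n : exists a, forall k, a - u n k \in ideal_exp m k.
  apply: compl => k; rewrite /u big_ord_recr /= [X in X - _]addrC addrK mulrC.
  by apply: ideal_expMl; apply: ideal_expX.
have [s sP] := choice ulim; exists s => n.
apply/eqP; rewrite -subr_eq0; apply/eqP/sep => k.
have uS : u n k.+1 = r n + x * u n.+1 k.
  rewrite /u big_ord_recl expr0 mul1r addn0 mulr_sumr; congr (_ + _).
  by apply: eq_bigr => i _; rewrite exprS mulrA addSnnS.
have -> : s n - (r n + x * s n.+1) =
    (s n - u n k.+1) + (- x) * (s n.+1 - u n.+1 k) by rewrite uS; ring.
apply: ideal_expD; last exact/ideal_expMl.
have := sP n k.+1; rewrite -addn1 => /ideal_exp_add[]; by rewrite addn1.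
Qed.

(** An ideal maximal among those above J containing no power of m would be prime: if m^k lies in Q +
    (a) and m^l in Q + (b), then m^(k+l) lies in Q + (ab). A prime above J contains m itself. *)
Lemma primary_ideal_exp (J : submod R^o) : noeth (sfull : submod R^o) szero ->
  primary (of_idealr m) J -> exists k, forall a, a \in ideal_exp m k -> J a.
Proof.
move=> R_noeth primJ; apply: contrapT => nJ.
pose P (I : submod R^o) := ~ exists k, forall a, a \in ideal_exp m k -> I a.
have [Q [{}nJ JQ max]] := noeth_max R_noeth (P := P) nJ.
have Q1 : ~ Q 1.
  by move=> Q1; apply: nJ; exists 0%N => a _; rewrite -(mulr1 a); apply: smemMl.
have pQ : prime_ideal Q.
  split=> // a b Qab; apply: contrapT => /not_orP[nQa nQb].
  have bigger c : ~ Q c -> exists k, forall y, y \in ideal_exp m k ->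
      exists j r, Q j /\ y = j + r * c.
    move=> nQc; apply: contrapT => nc; apply: nQc.
    rewrite -(max (sadd Q (scyc (c : R^o)))); last exact: sle_addl.
      by apply: sle_addr; apply: scyc_id.
    by case=> k kP; apply: nc; exists k => y /kP /sadd_scycP.
  have [[k ka] [l lb]] := (bigger a nQa, bigger b nQb).
  apply: nJ; exists (k + l)%N => y /asboolP[n [c [t [tm ->]]]].
  apply: smem_sum => i _; apply: smemMl.
  have prodm j (v : j.-tuple R) : {subset v <= m} -> \prod_(x <- v) x \in ideal_exp m j.
    move=> vm; apply/asboolP; exists 1%N, (fun=> 1), (fun=> v).
    by split=> //; rewrite big_ord1 mul1r.
  rewrite -(cat_take_drop k (t i)) big_cat /=.
  have szk : size (take k (t i)) == k by rewrite size_takel // size_tuple leq_addr.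
  have szl : size (drop k (t i)) == l by rewrite size_drop size_tuple addKn.
  have [|i1 [r1 [Q1' ->]]] := ka (\prod_(x <- take k (t i)) x).
    by apply: (prodm k (Tuple szk)) => x /mem_take /tm.
  have [|i2 [r2 [Q2' ->]]] := lb (\prod_(x <- drop k (t i)) x).
    by apply: (prodm l (Tuple szl)) => x /mem_drop /tm.
  have -> : (i1 + r1 * a) * (i2 + r2 * b) =
    (i2 + r2 * b) * i1 + r1 * a * i2 + r1 * r2 * (a * b) by ring.
  by apply: smemD; [apply: smemD|]; apply: smemMl.
apply: nJ; exists 1%N => y /asboolP[n [c [t [tm ->]]]].
apply: smem_sum => i _; apply: smemMl.
rewrite big_tuple big_ord1; have mt := tm i _ (mem_tnth ord0 (t i)).
by have [k /JQ] := primJ _ mt; apply: prime_pow.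
Qed.

End IdealPowers.

(** * Units and systems of parameters in a noetherian local ring *)

Section LocalRing.
Variables (R : comNzRingType) (m : idealr R).
Hypothesis R_noeth : noeth (sfull : submod R^o) szero.
Hypothesis R_local : local_ring m.

Lemma of_idealr1 : ~ of_idealr m 1.
Proof. by rewrite /= idealr1. Qed.

Lemma of_idealr_unit (r : R) : ~ of_idealr m r -> exists u : R, u * r = 1.
Proof.
move=> nmr; apply: contrapT => nu.
have [|J [J1 rJ max]] := noeth_max R_noeth (P := fun J => ~ J 1) (J0 := scyc (r : R^o)).
  by case=> u _ uE; apply: nu; exists u.
have JE : idealr_of J1 =i m.
  apply: R_local.2 => I sI a.
  have IJ : of_idealr I = J.
    apply: max; first by rewrite /= idealr1.
    by move=> b Jb; apply: sI; apply/asboolP.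
  by apply/idP/asboolP; rewrite -IJ.
by apply: nmr; rewrite /= -JE; apply/asboolP/rJ/scyc_id.
Qed.

Lemma sop_of_primary d (x : d.-tuple R) : krull_dim R d ->
  (forall y, y \in (x : seq R) -> y \in m) ->
  primary (of_idealr m) (sgen (szero : submod R^o) x) -> system_of_parameters m x.
Proof.
move=> dimR xm prim; split=> // a; apply/asboolP/idP => [[k /ideal_genP]|ma].
  move=> /(sgen_le (@sle0 _ _ (of_idealr m)) xm).
  exact: (prime_pow (prime_M of_idealr1 of_idealr_unit)).
by have [k ak] := prim a ma; exists k; apply/ideal_genP.
Qed.

End LocalRing.

(** * Top local cohomology *)

Section Subcomplex.
Variables (R : comNzRingType) (C : cochain_complex R).
Notation d := (cc_diff C).
Implicit Types (A : forall n, submod (C n)) (x : R).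

Definition cob A n : submod (C n) :=
  match n return submod (C n) with
  | 0 => szero
  | k.+1 => simg (cc_diff C k) (A k)
  end.

Definition subcomplex A : Prop := forall n v, A n v -> A n.+1 (d n v).
Definition exact_at A n : Prop := forall z, A n z -> d n z = 0 -> cob A n z.
Definition divisible_by A x : Prop :=
  forall n v, A n v -> exists2 w, A n w & x *: w = v.
Definition kill A x n : submod (C n) := killed (A n) x.

Fixpoint kill_seq A (s : seq R) : forall n, submod (C n) :=
  if s is x :: s' then kill_seq (kill A x) s' else A.

Fixpoint divisible_seq A (s : seq R) : Prop :=
  if s is x :: s' then divisible_by A x /\ divisible_seq (kill A x) s' else True.

Definition nilpotent_on A x : Prop := forall n, power_torsion (A n) x.

Lemma kill_le A x n : kill A x n <=s A n.
Proof. exact: scap_lel. Qed.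

Lemma cob_mono A B n : (forall k, A k <=s B k) -> cob A n <=s cob B n.
Proof. by move=> AB; case: n => [|n] //= _ [w /AB Bw ->]; exists w. Qed.

Lemma subcomplex_kill A x : subcomplex A -> subcomplex (kill A x).
Proof.
move=> sA n v [Av xv]; split; first exact: sA.
have xv0 : x *: v = 0 by [].
by rewrite /= /homothety -linearZ xv0 linear0.
Qed.

Lemma nilpotent_kill A x y : nilpotent_on A y -> nilpotent_on (kill A x) y.
Proof. by move=> Ay n v [Av _]; apply: Ay. Qed.

(** Part of the long exact sequence of 0 -> A[x] -> A -> A -> 0: the vanishing of H^(n-1)(A) makes
    H^n(A[x]) -> H^n(A) injective. *)
Lemma cob_kill A x n z : subcomplex A -> divisible_by A x ->
  (forall k, n = k.+1 -> exact_at A k) ->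
  kill A x n z -> cob A n z -> cob (kill A x) n z.
Proof.
move=> sA Ax; case: n z => [|k] z ex //= [Akz xz] [w Aw Ez].
have xz0 : x *: z = 0 by [].
have cxw : d k (x *: w) = 0 by rewrite linearZ /= -Ez.
have := ex k erefl _ (smemZ x Aw) cxw.
case: k z ex w Aw Ez {cxw Akz xz xz0} => [|l] z ex w Aw Ez.
  by move=> /= xw; exists w.
case=> v /Ax[v' Av' <-] E.
exists (w - d l v'); last by rewrite linearB /= cc_diffK subr0.
split; first by apply: smemB => //; apply: sA.
by rewrite /= /homothety scalerBr E linearZ /= subrr.
Qed.

(** Exactness at the middle term: a class killed by [x] comes from A[x], after dividing by [x] a
    cochain that bounds x z. *)
Lemma cob_lift A x n z : subcomplex A -> divisible_by A x ->
  A n z -> d n z = 0 -> cob A n (x *: z) ->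
  exists z', [/\ kill A x n z', d n z' = 0 & cob A n (z - z')].
Proof.
move=> sA Ax; case: n z => [|k] z Az dz.
  move=> xz; exists z; split=> //; by rewrite subrr; apply: smem0.
case=> w /Ax[w' Aw' <-] E; exists (z - d k w'); split.
- split; first by apply: smemB => //; apply: sA.
  by rewrite /= /homothety scalerBr E linearZ /= subrr.
- by rewrite linearB /= cc_diffK dz subrr.
- by rewrite opprB addrC subrK; exists w'.
Qed.

(** If H^n(A[x]) = 0 then [x] is injective on H^n(A), where every class is killed by a power of
    [x]. *)
Lemma exact_of_kill A x N : subcomplex A -> divisible_by A x -> nilpotent_on A x ->
  (forall n, (n < N)%N -> exact_at (kill A x) n) ->
  forall n, (n < N)%N -> exact_at A n.
Proof.
move=> sA Ax nilA ex n nN z Az dz; have [k xkz] := nilA n z Az.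
elim: k z Az dz xkz => [|k IH] z Az dz; first by rewrite expr0 scale1r => ->; apply: smem0.
rewrite exprSr -scalerA => xkz.
have cxz : cob A n (x *: z).
  by apply: IH xkz; [apply: smemZ|rewrite linearZ /= dz scaler0].
have [z' [Az' dz' czz']] := cob_lift sA Ax Az dz cxz.
rewrite -(subrK z' z); apply: smemD => //.
by apply: (cob_mono (@kill_le A x)); apply: ex.
Qed.

Lemma exact_of_kill_seq A s N : subcomplex A -> divisible_seq A s ->
  (forall x, x \in s -> nilpotent_on A x) ->
  (forall n, (n < N)%N -> exact_at (kill_seq A s) n) ->
  forall n, (n < N)%N -> exact_at A n.
Proof.
elim: s A => [|x s IH] A sA //= [Ax As] nilA ex.
apply: (exact_of_kill sA Ax); first by apply: nilA; rewrite inE eqxx.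
apply: IH => //; first exact: subcomplex_kill.
by move=> y ys; apply/nilpotent_kill/nilA; rewrite inE ys orbT.
Qed.

(** Iterates [cob_lift]. The remaining elements still kill the lifted class in A[x], because the
    lower cohomology of [A] vanishes and [cob_kill] applies. *)
Lemma cob_lift_seq A s N z : subcomplex A -> divisible_seq A s ->
  (forall x, x \in s -> nilpotent_on A x) ->
  (forall n, (n < N)%N -> exact_at (kill_seq A s) n) ->
  A N z -> d N z = 0 -> (forall x, x \in s -> cob A N (x *: z)) ->
  exists z', [/\ kill_seq A s N z', d N z' = 0 & cob A N (z - z')].
Proof.
elim: s A z => [|x s IH] A z sA /=.
  by move=> _ _ _ Az dz _; exists z; split=> //; rewrite subrr; apply: smem0.
move=> [Ax As] nilA ex Az dz cz.
have nilA' y : y \in s -> nilpotent_on (kill A x) y.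
  by move=> ys; apply/nilpotent_kill/nilA; rewrite inE ys orbT.
have sA' : subcomplex (kill A x) by apply: subcomplex_kill.
have exA : forall n, (n < N)%N -> exact_at A n.
  by apply: (@exact_of_kill_seq A (x :: s)).
have [|z1 [Az1 dz1 cz1]] := cob_lift sA Ax Az dz; first by apply: cz; rewrite inE eqxx.
have [|z2 [Az2 dz2 cz2]] := IH _ z1 sA' As nilA' ex Az1 dz1.
  move=> y ys; apply: cob_kill => //; last 2 first.
  - exact: smemZ.
  - rewrite (_ : y *: z1 = y *: z - y *: (z - z1)); last by rewrite scalerBr opprB addrC subrK.
    by apply: smemB; [apply: cz; rewrite inE ys orbT|apply: smemZ].
  by move=> k Ek; apply: exA; rewrite Ek.
exists z2; split=> //; rewrite -(subrK z1 z) -addrA; apply: smemD => //.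
exact: cob_mono (@kill_le A x) _ cz2.
Qed.

(* The cohomology of A is R / J, concentrated in degree j. *)
Definition cyclic_cohomology A (J : submod R^o) j : Prop :=
  [/\ forall n, annihilates J (A n) szero,
      forall n, n <> j -> exact_at A n
    & exists g, [/\ A j g, d j g = 0,
        forall z, A j z -> d j z = 0 -> exists r : R, cob A j (z - r *: g)
      & forall r : R, cob A j (r *: g) -> J r]].

(** By the long exact sequence the connecting map identifies H^j(A) modulo [x] with H^(j+1)(A[x]).
    The new generator is d h, where x h = g. *)
Lemma cyclic_cohomology_kill A (J : submod R^o) j x : subcomplex A -> divisible_by A x ->
  (forall a : R, J (x * a) -> J a) -> cyclic_cohomology A J j ->
  cyclic_cohomology (kill A x) (sadd J (scyc (x : R^o))) j.+1.
Proof.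
move=> sA Ax Jx [JA ex [g [Ag dg genA Jg]]]; split.
- move=> n _ v [i [_ [Ji [r _ ->] ->]]] [Av xv]; rewrite scalerDl.
  apply: smemD; first exact: JA Av.
  have xv0 : x *: v = 0 by [].
  by change ((r * x) *: v = 0); rewrite -scalerA xv0 scaler0.
- move=> n nj z [Az xz] dz.
  have xz0 : x *: z = 0 by [].
  apply: cob_kill => //; first by move=> k Ek; apply: ex => Ej; apply: nj; rewrite Ek Ej.
  have [Enj|] := pselect (n = j); last by move=> nnj; apply: ex.
  subst n; have [r czr] := genA z Az dz.
  have Jr : J r.
    apply/Jx/Jg; rewrite -scalerA (_ : r *: g = z - (z - r *: g)).
      by rewrite scalerBr xz0 sub0r; apply/smemN/smemZ.
    by rewrite opprB addrC subrK.
  have rg0 : r *: g = 0 := JA _ _ _ Jr Ag.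
  by move: czr; rewrite rg0 subr0.
have [h Ah Eh] := Ax j g Ag.
exists (d j h); split.
- split; first exact: sA.
  by rewrite /= /homothety -linearZ Eh dg.
- exact: cc_diffK.
- move=> z [Az xz] dz; have xz0 : x *: z = 0 by [].
  have [w Aw Ez] : cob A j.+1 z by apply: ex => // /eqP; rewrite eqn_leq ltnn.
  have [|r cr] := genA (x *: w) (smemZ x Aw).
    by rewrite linearZ /= -Ez.
  exists r.
  suff [t At Et] : exists2 t, kill A x j t & z = r *: d j h + d j t.
    by exists t => //; rewrite Et addrC addKr.
  (* The difference is a coboundary, and dividing its primitive by [x] makes it x times a cocycle.
     In degree 0 it is zero. *)
  have [v [Av dv0 Ev]] : exists v, [/\ A j v, d j v = 0 & x *: v = x *: w - r *: g].
    clear - cr Ax sA Aw Ag.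
    case: j g Ag w Aw cr => [|k] g Ag w Aw.
      by move=> /= ->; exists 0; split; rewrite ?linear0 ?scaler0 //; apply: smem0.
    case=> u /Ax[u' Au' <-] ->; exists (d k u'); split; first exact: sA.
      exact: cc_diffK.
    by rewrite linearZ.
  exists (w - v - r *: h); last by rewrite !linearB /= linearZ /= dv0 subr0 addrC subrK.
  split; first by apply: smemB; [apply: smemB|apply: smemZ].
  rewrite /= /homothety !scalerBr Ev scalerA mulrC -scalerA Eh.
  by rewrite opprB [X in X - _]addrC subrK subrr.
- move=> r [t [At xt] Et].
  (* The cocycle r h - t is cohomologous to some q g. Multiplying by [x] makes (r - x q) g a
     coboundary, so r - x q lies in [J]. *)
  have xt0 : x *: t = 0 by [].
  have [||q cq] := genA (r *: h - t).
  - by apply: smemB => //; apply: smemZ.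
  - by rewrite linearB linearZ /= Et subrr.
  have Jr : J (r - x * q).
    apply: Jg; rewrite scalerBl -{1}Eh -scalerA.
    rewrite (_ : _ - _ = x *: (r *: h - t - q *: g)); first exact: smemZ.
    by rewrite !scalerBr xt0 subr0 !scalerA mulrC.
  exists (r - x * q), (x * q); split=> //; last by rewrite subrK.
  by exists q => //; rewrite mulrC.
Qed.

End Subcomplex.

(** * Annihilators of ideals, and divisibility of injective modules *)

Section Annihilator.
Variables (R : comNzRingType).

Definition annih (V : lmodType R) (J : submod R^o) : submod V.
Proof.
exists (fun v => forall c : R, J c -> c *: v = 0).
- by move=> c _; rewrite scaler0.
- by move=> u v Ju Jv c Jc; rewrite scalerDr Ju ?Jv ?addr0.
- by move=> a v Jv c Jc; rewrite scalerA mulrC -scalerA Jv ?scaler0.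
Defined.

Lemma annih_killed (V : lmodType R) (J : submod R^o) (x : R) :
  killed (annih V J) x = annih V (sadd J (scyc (x : R^o))).
Proof.
apply: submod_eqP => [v [Jv xv] c /sadd_scycP[j [r [Jj ->]]]|v Jv].
  have xv0 : x *: v = 0 by [].
  by rewrite scalerDl -scalerA xv0 scaler0 addr0 Jv.
split=> [c Jc|]; first by apply: Jv; apply: sle_addl.
by apply: Jv; apply: sle_addr; apply: scyc_id.
Qed.

Lemma annih_sgen (V : lmodType R) (J : submod R^o) (s : seq R) (v : V) :
  annih V J v -> (forall y : R, y \in s -> y *: v = 0) -> annih V (sgen J s) v.
Proof.
elim: s J => [|y s IH] J Jv sv; first exact: Jv.
have Jyv : annih V (sadd J (scyc (y : R^o))) v.
  by rewrite -annih_killed; split=> //; apply: sv; rewrite inE eqxx.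
by apply: (IH _ Jyv) => z zs; apply: sv; rewrite inE zs orbT.
Qed.

(** The annihilator of [J] in [I] is Hom(R/J, I). The map sending 1 to [u] extends along the
    injection x : R/J -> R/J, and the image of 1 under the extension is the required element. *)
Lemma injective_divisible (I : lmodType R) (J : submod R^o) (x : R) (u : I) :
  injective_module I -> (forall a : R, J (x * a) -> J a) -> annih I J u ->
  exists2 w, annih I J w & x *: w = u.
Proof.
move=> injI Jx Ju.
pose Q : lmodType R := quotient_module (submod_closed_of J).
pose p (r : R^o) : Q := \pi_(Quotient.quot (submod_zmod (submod_closed_of J)))%qT r.
have pE (r s : R) : p r = p s <-> J (r - s).
  split=> [/eqP|Jrs]; first by rewrite -Quotient.idealrBE => /submod_closed_ofP.
  by apply/eqP; rewrite -Quotient.idealrBE; apply/submod_closed_ofP.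
have pZ (a : R) (r : R) : a *: p r = p (a * r) by apply: quotient_scaleE.
have pB (r s : R) : p r - p s = p (r - s) by rewrite /p raddfB.
have pD (r s : R) : p r + p s = p (r + s) by rewrite /p raddfD.
have p_surj q : exists r, p r = q by exists (repr q); apply: reprK.
pose g0 (q : Q) : I := (repr q : R) *: u.
have g0E (r : R) : g0 (p r) = r *: u.
  apply/eqP; rewrite -subr_eq0 -scalerBl; apply/eqP/Ju/pE.
  exact: reprK.
have g0_lin : linear g0.
  move=> a q q'; have [[r <-] [r' <-]] := (p_surj q, p_surj q').
  by rewrite pZ pD !g0E scalerDl scalerA.
pose g := HB.pack_for {linear Q -> I} g0 (GRing.isLinear.Build R Q I _ g0 g0_lin).
have [|h hE] := injI Q Q (@homothety R Q x) g.
  move=> q q'; have [[r <-] [r' <-]] := (p_surj q, p_surj q').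
  rewrite !homothetyE !pZ => /pE; rewrite -mulrBr => /Jx Jrr.
  exact/pE.
exists (h (p 1)).
  move=> c Jc; rewrite -linearZ /= pZ mulr1.
  have -> : p c = p 0 by apply/pE; rewrite subr0.
  by rewrite /p raddf0 linear0.
rewrite -linearZ /=; have := hE (p 1); rewrite homothetyE => ->.
by have := g0E 1; rewrite scale1r.
Qed.

End Annihilator.

(** * Annihilator and torsion subcomplexes of an injective resolution of R *)

Section Resolution.
Variables (R : comNzRingType) (I : injective_resolution R^o).
Notation C := (ir_complex I).
Notation d := (cc_diff C).

Definition ann_complex (J : submod R^o) n : submod (C n) := annih (C n) J.

Lemma ann_complex_kill J x : kill (ann_complex J) x = ann_complex (sadd J (scyc (x : R^o))).
Proof. by apply: functional_extensionality_dep => n; apply: annih_killed. Qed.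

Lemma ann_complex_sub J : subcomplex (ann_complex J).
Proof. by move=> n v Jv c Jc; rewrite -linearZ /= Jv ?linear0. Qed.

Lemma ann_complex_divisible (J : submod R^o) (x : R) :
  (forall a : R, J (x * a) -> J a) -> divisible_by (ann_complex J) x.
Proof. by move=> Jx n v Jv; apply: injective_divisible => //; apply: ir_injective. Qed.

(* Rees: Ext^i(R / (s), R) is R / (s) for i = size s and vanishes otherwise. *)
Lemma ann_complex_cohomology J j (s : seq R) : regular J s ->
  cyclic_cohomology (ann_complex J) J j ->
  cyclic_cohomology (ann_complex (sgen J s)) (sgen J s) (j + size s).
Proof.
elim: s J j => [|x s IH] J j /=; first by rewrite addn0.
move=> [Jx reg_s] cycJ; rewrite addnS -addSn; apply: IH => //.
rewrite -ann_complex_kill; apply: cyclic_cohomology_kill => //.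
- exact: ann_complex_sub.
- exact: ann_complex_divisible.
Qed.

Lemma resolution_cohomology : cyclic_cohomology (ann_complex szero) szero 0.
Proof.
have full n v : ann_complex szero n v by move=> c ->; rewrite scale0r.
split.
- by move=> n c v -> _; rewrite scale0r.
- case=> // n _ z _ /ir_exact[y <-]; by exists y.
exists (ir_aug I 1); split=> //.
- by apply/ir_exact0; exists 1.
- move=> z _ /ir_exact0[r <-]; exists r.
  by rewrite -linearZ /= -linearB /= (_ : r - r *: (1 : R^o) = 0) ?linear0 //
     [_ *: _]mulr1 subrr.
- move=> r /= /eqP; rewrite -linearZ /= -(linear0 (ir_aug I)).
  by move=> /eqP /(@ir_aug_inj _ _ I); rewrite [_ *: _]mulr1.
Qed.

Variable m : idealr R.
Hypothesis R_noeth : noeth (sfull : submod R^o) szero.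
Hypothesis R_local : local_ring m.

Definition tors (V : lmodType R) : submod V.
Proof.
exists (fun v => exists k, forall a, a \in ideal_exp m k -> a *: v = 0).
- by exists 0%N => a _; rewrite scaler0.
- move=> u v [k ku] [l lv]; exists (k + l)%N => a /ideal_exp_add[ak al].
  by rewrite scalerDr ku // lv // addr0.
- by move=> b v [k kv]; exists k => a ak; rewrite scalerA mulrC -scalerA kv ?scaler0.
Defined.

Lemma annih_tors (V : lmodType R) (J : submod R^o) : primary (of_idealr m) J ->
  annih V J <=s tors V.
Proof.
move=> /(primary_ideal_exp R_noeth)[k kJ] v Jv.
by exists k => a /kJ /Jv.
Qed.

Lemma tors_power_torsion (V : lmodType R) x : x \in m -> power_torsion (tors V) x.
Proof. by move=> mx v [k kv]; exists k; apply: kv; apply: ideal_expX. Qed.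

Definition tors_complex (J : submod R^o) n : submod (C n) :=
  scap (annih (C n) J) (tors (C n)).

Lemma tors_complex_kill J x :
  kill (tors_complex J) x = tors_complex (sadd J (scyc (x : R^o))).
Proof.
apply: functional_extensionality_dep => n; rewrite /tors_complex -annih_killed.
by apply: submod_eqP => [v [[Jv tv] xv]|v [[Jv xv] tv]].
Qed.

Lemma tors_complex_sub J : subcomplex (tors_complex J).
Proof.
move=> n v [Jv [k kv]]; split; first exact: ann_complex_sub.
by exists k => a ak; rewrite -linearZ /= kv ?linear0.
Qed.

(** Dividing inside the annihilator of [J] alone could leave the torsion part. As [u] is killed by
    high powers of the remaining parameters, the division is done inside the annihilator of the
    larger ideal J', modulo which [x] is still regular. *)
Lemma tors_complex_divisible (J : submod R^o) (x : R) (s : seq R) :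
  regular J (x :: s) -> (forall y, y \in x :: s -> y \in m) ->
  primary (of_idealr m) (sgen J (x :: s)) -> divisible_by (tors_complex J) x.
Proof.
have M1 := @of_idealr1 _ m; have M_unit := of_idealr_unit R_noeth R_local.
move=> reg_s sm prim n u [Ju [k ku]].
have mx : x \in m by apply: sm; rewrite inE eqxx.
have sm' y : y \in s -> y \in m by move=> ys; apply: sm; rewrite inE ys orbT.
pose J' := sgen J [seq y ^+ k.+1 | y <- s].
have pow0 y : y \in m -> y ^+ k.+1 *: u = 0.
  by move=> my; rewrite exprS -scalerA ku ?scaler0 //; apply: ideal_expX.
have J'u : annih (C n) J' u.
  by apply: annih_sgen => // _ /mapP[y /sm' my ->]; apply: pow0.
have [w J'w xw] := injective_divisible (@ir_injective _ _ I n)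
  (regular_head_powers R_noeth M1 M_unit mx sm' reg_s (n := k)) J'u.
exists w => //; split.
  by move=> c Jc; apply: J'w; apply: sgen_ge.
(* Since x w = u and x^(k+1) kills [u], the exponent k+2 kills [w]; this primary ideal makes [w]
   torsion. *)
pose K := sgen J' [:: (x ^+ k.+2 : R^o)].
apply: (@annih_tors _ K).
  apply/(primaryP R_noeth) => P pP KP.
  apply: ((primaryP R_noeth _ _).1 prim P pP).
  apply: sgen_le; first by apply: sle_trans KP; apply: sle_trans (@sgen_ge _ _ _ _); apply: sgen_ge.
  move=> y; rewrite inE => /orP[/eqP ->|ys].
    by apply: (@prime_pow _ _ _ k.+2 pP); apply/KP/sgen_mem; rewrite inE eqxx.
  apply: (@prime_pow _ _ _ k.+1 pP); apply/KP/sgen_ge/sgen_mem.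
  exact: (map_f (fun y : R => y ^+ k.+1)).
apply: annih_sgen => // y; rewrite inE => /eqP ->.
by rewrite exprSr -scalerA xw pow0.
Qed.

Lemma tors_complex_divisible_seq (J : submod R^o) (s : seq R) :
  regular J s -> (forall y, y \in s -> y \in m) ->
  primary (of_idealr m) (sgen J s) -> divisible_seq (tors_complex J) s.
Proof.
elim: s J => [|x s IH] J // reg_s sm prim; split.
  exact: tors_complex_divisible prim.
rewrite tors_complex_kill; apply: IH => //; first by case: reg_s.
by move=> y ys; apply: sm; rewrite inE ys orbT.
Qed.

Lemma tors_complex_kill_seq (J : submod R^o) (s : seq R) :
  kill_seq (tors_complex J) s = tors_complex (sgen J s).
Proof. by elim: s J => //= x s IH J; rewrite tors_complex_kill IH. Qed.

Lemma tors_complex_primary J : primary (of_idealr m) J -> tors_complex J = ann_complex J.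
Proof.
move=> prim; apply: functional_extensionality_dep => n.
by apply: scap_idl; apply: annih_tors.
Qed.

(** Elements killed by the primary ideal (s) are already torsion, so inside the torsion complex they
    form Hom(R/(s), I), whose cohomology is R/(s) in degree [size s]. Classes killed by [s] lift to
    it by [cob_lift_seq]. *)
Lemma top_cocycles (s : seq R) : regular (szero : submod R^o) s ->
  (forall y, y \in s -> y \in m) ->
  primary (of_idealr m) (sgen (szero : submod R^o) s) ->
  exists g, [/\ tors_complex (sgen (szero : submod R^o) s) (size s) g, d (size s) g = 0
    & forall z, tors (C (size s)) z -> d (size s) z = 0 ->
      (forall x, x \in s -> cob (tors_complex szero) (size s) (x *: z)) ->
      exists r : R, cob (tors_complex szero) (size s) (z - r *: g)].
Proof.
move=> reg_s sm prim.
have [_ ex [g [Ag dg genA _]]] := ann_complex_cohomology reg_s resolution_cohomology.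
rewrite add0n in ex g Ag dg genA.
have EA := tors_complex_primary prim.
exists g; rewrite EA; split=> // z tz dz cz.
have Az : tors_complex szero (size s) z by split=> // c ->; rewrite scale0r.
have [||n nN|z' [Az' dz' czz']] := @cob_lift_seq _ C (tors_complex szero) s (size s) z
  (@tors_complex_sub _) _ _ _ Az dz cz.
- exact: tors_complex_divisible_seq.
- by move=> x /sm mx n v [_ tv]; apply: (tors_power_torsion mx tv).
- rewrite tors_complex_kill_seq EA; apply: ex => E; by rewrite E ltnn in nN.
rewrite tors_complex_kill_seq EA in Az'.
have [r cr] := genA z' Az' dz'; exists r.
rewrite -(subrK z' z) -addrA; apply: smemD => //.
apply: cob_mono cr => n; rewrite -EA => v [_ tv]; split=> // c ->.
by rewrite scale0r.
Qed.

(** ** Classes in local cohomology *)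

Variable N : nat.
Notation H := (local_cohomology m I N).

(** Relates a class to a representative in the resolution itself, hiding the two nested subtypes and
    the quotient. *)
Definition class_of (h : H) (z : C N) : Prop :=
  exists c : cocycles (Gamma_complex m C) N,
    \pi_(Quotient.quot (submod_zmod (coboundaries (Gamma_complex m C) N)))%qT c = h /\
    submodule_val (submodule_val c) = z.

Lemma class_ex h : exists z, class_of h z.
Proof. by exists (submodule_val (submodule_val (repr h))), (repr h); split=> //; apply: reprK. Qed.

Lemma class_cocycle h z : class_of h z -> tors (C N) z /\ d N z = 0.
Proof.
case=> [[[v tv] dv]] [_ <-] /=; split; first by have /asboolP := tv.
by have /eqP /(congr1 (@submodule_val _ _ _)) := dv.
Qed.

Lemma class_of_cocycle z : tors (C N) z -> d N z = 0 -> exists h, class_of h z.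
Proof.
move=> tz dz.
have tz' : z \in torsion m (C N) by apply/asboolP.
have dz' : (Submodule tz' : Gamma m (C N)) \in kernel (cc_diff (Gamma_complex m C) N).
  by apply/eqP; apply: val_inj.
by eexists; exists (Submodule dz'); split.
Qed.

Lemma class_Z h z a : class_of h z -> class_of (a *: h) (a *: z).
Proof.
by case=> c [<- <-]; exists (a *: c); split=> //; apply/esym/quotient_scaleE.
Qed.

Lemma class_B h z h' z' : class_of h z -> class_of h' z' -> class_of (h - h') (z - z').
Proof.
by move=> [c [<- <-]] [c' [<- <-]]; exists (c - c'); split=> //; rewrite raddfB.
Qed.

Lemma class_eq0 h z : class_of h z -> h = 0 <-> cob (tors_complex szero) N z.
Proof.
case=> c [<- <-].
rewrite -(raddf0 \pi_(Quotient.quot (submod_zmod (coboundaries (Gamma_complex m C) N)))%qT).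
have -> : (\pi_(Quotient.quot (submod_zmod (coboundaries (Gamma_complex m C) N)))%qT c =
  \pi_(Quotient.quot (submod_zmod (coboundaries (Gamma_complex m C) N)))%qT 0) <->
  is_coboundary (submodule_val c).
  split=> [/eqP|cc]; first by rewrite -Quotient.idealrBE subr0 => /asboolP.
  by apply/eqP; rewrite -Quotient.idealrBE subr0; apply/asboolP.
case: (N) c => [|k] c /=.
  split=> [-> //|E]; exact: val_inj.
split=> [[[w tw] <-]|[w [_ tw] E]]; last first.
  have tw' : w \in torsion m (C k) by apply/asboolP.
  by exists (Submodule tw'); apply: val_inj.
exists w => //; split=> [c' ->|]; first by rewrite scale0r.
by have /asboolP := tw.
Qed.

Lemma local_cohomology_torsion (h : H) : tors H h.
Proof.
have [z zh] := class_ex h; have [[k kz] _] := class_cocycle zh.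
exists k => a /kz az; apply/(class_eq0 (class_Z a zh)).
by rewrite az; apply: smem0.
Qed.

Lemma top_local_cohomology_cyclic (s : seq R) : size s = N ->
  regular (szero : submod R^o) s -> (forall y, y \in s -> y \in m) ->
  primary (of_idealr m) (sgen (szero : submod R^o) s) ->
  exists g : H, annih H (sgen (szero : submod R^o) s) g /\
    forall h : H, (forall x, x \in s -> x *: h = 0) -> exists r : R, h = r *: g.
Proof.
move=> szs reg_s sm prim.
have := top_cocycles reg_s sm prim; rewrite szs => -[g [[Jg tg] dg gen]].
have [hg gP] := class_of_cocycle tg dg; exists hg; split.
  move=> c Jc; apply/(class_eq0 (class_Z c gP)); rewrite Jg //; exact: smem0.
move=> h sh; have [z zh] := class_ex h; have [tz dz] := class_cocycle zh.
have [|r cr] := gen z tz dz.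
  by move=> x xs; apply/(class_eq0 (class_Z x zh)); apply: sh.
exists r; apply/eqP; rewrite -subr_eq0; apply/eqP.
exact/(class_eq0 (class_B zh (class_Z r gP))).
Qed.

End Resolution.

(** * Submodules of the top local cohomology *)

Lemma killed_seqP (R : comNzRingType) (V : lmodType R) (N : submod V) (s : seq R) v :
  killed_seq N s v <-> N v /\ forall x, x \in s -> x *: v = 0.
Proof.
elim: s N => [|x s IH] N; first by split=> [|[]].
rewrite [killed_seq _ _]/= IH; split=> [[[Nv xv] sv]|[Nv sv]].
  by split=> // y; rewrite inE => /orP[/eqP ->|/sv].
split=> [|y ys]; last by apply: sv; rewrite inE ys orbT.
by split=> //; apply: sv; rewrite inE eqxx.
Qed.

Lemma killed_seq_rcons (R : comNzRingType) (V : lmodType R) (N : submod V) (s : seq R) x :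
  killed_seq N (rcons s x) = killed (killed_seq N s) x.
Proof. by elim: s N => //= y s IH N. Qed.

(** Among the nonzero multiples of [v] take one with maximal annihilator. If [y] did not kill it,
    its product with [y] would have the same annihilator, contradicting the nilpotent action of
    [y]. *)
Lemma socle_element (R : comNzRingType) (m : idealr R) (V : lmodType R) (v : V) :
  noeth (sfull : submod R^o) szero -> tors m V v -> v <> 0 ->
  exists r : R, r *: v <> 0 /\ forall y, y \in m -> y *: (r *: v) = 0.
Proof.
move=> R_noeth [k kv] v0.
pose P (J : submod R^o) := exists r : R, r *: v <> 0 /\
  J = spre (orbit_map (r *: v)) szero.
have [|J [[r [rv0 EJ]] _ max]] := @noeth_max _ R_noeth P (spre (orbit_map ((1 : R) *: v)) szero).
  by exists 1; rewrite scale1r.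
exists r; split=> // y my; apply: contrapT => yrv.
have EJy : spre (orbit_map ((y * r) *: v)) szero = J.
  apply: max; first by exists (y * r); rewrite -scalerA.
  rewrite EJ => a arv; have arv0 : (a : R) *: (r *: v) = 0 by [].
  change ((a : R) *: ((y * r) *: v) = 0).
  by rewrite scalerA mulrCA -!scalerA arv0 scaler0.
have : y ^+ k *: (r *: v) = 0 by rewrite scalerA mulrC -scalerA kv ?scaler0 //; apply: ideal_expX.
elim: k {kv} => [|k IH]; first by rewrite expr0 scale1r.
rewrite exprSr -scalerA => yk; apply: IH.
have : J (y ^+ k) by rewrite -EJy /= /orbit_map -scalerA.
by rewrite EJ.
Qed.

(** By Zorn. In V / W every nonzero submodule contains the class of [v], so V / W can serve as a
    target with simple socle once [m] kills [v]. *)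
Lemma maximal_avoiding (R : comNzRingType) (V : lmodType R) (v : V) : v <> 0 ->
  exists W : submod V, ~ W v /\ forall W' : submod V, W <=s W' -> ~ W' v -> W' <=s W.
Proof.
move=> v0.
pose T := {W : submod V | ~ W v}.
pose le (A B : T) := `[< sval A <=s sval B >].
have n0 : ~ (szero : submod V) v by [].
have [||||W Wmax] := @Zorn T le.
- by move=> A; apply/asboolP.
- by move=> A B C /asboolP AB /asboolP BC; apply/asboolP; apply: sle_trans BC.
- move=> [A nA] [B nB] /asboolP /= AB /asboolP /= BA.
  have E : A = B by apply: submod_eqP.
  by subst B; congr exist; apply: Prop_irrelevance.
- move=> F Ftot; have [[A0 FA0]|F0] := pselect (exists A, F A); last first.
    by exists (exist _ szero n0) => A FA; case: F0; exists A.
  have join A B : F A -> F B -> exists2 C, F C & sval A <=s sval C /\ sval B <=s sval C.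
    by move=> FA FB; have [/asboolP AB|/asboolP BA] := Ftot A B FA FB;
      [exists B|exists A] => //; split.
  unshelve eexists (exist _ (@Submod R V (fun w => exists2 A, F A & sval A w) _ _ _) _).
  + by exists A0 => //; apply: smem0.
  + move=> u w [A FA Au] [B FB Bw]; have [C FC [AC BC]] := join A B FA FB.
    by exists C => //; apply: smemD; [apply: AC|apply: BC].
  + by move=> a w [A FA Aw]; exists A => //; apply: smemZ.
  + by move=> [[A nA] _ /= /nA].
  + by move=> A FA; apply/asboolP => w Aw; exists A.
exists (sval W); split=> [|W' WW' nW'v]; first exact: svalP W.
have W'W : exist _ W' nW'v = W by apply: Wmax; apply/asboolP.
by rewrite -W'W.
Qed.

Section TopLocalCohomology.
Variables (R : idomainType) (m : idealr R) (d : nat).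
Hypothesis R_noetherian : noetherian R.
Hypothesis R_local : local_ring m.
Hypothesis R_dim : krull_dim R d.
Hypothesis R_complete : adically_complete m.
Variable I : injective_resolution R^o.
Notation H := (local_cohomology m I d).
Variable E : submodClosed H.

Definition submod_of : submod H.
Proof.
exists (fun v => v \in E); [exact: rpred0|exact: rpredD|].
by move=> a v Ev; apply: rpredZ.
Defined.

Hypothesis E_div : highly_divisible m d (submodule E).

Let R_noeth := noetherian_noeth R_noetherian.
Let M1 := @of_idealr1 R m.
Let M_unit := of_idealr_unit R_noeth R_local.

Lemma highly_divisible_seq (s : seq R) : size s = d ->
  (forall y, y \in s -> y \in m) ->
  primary (of_idealr m) (sgen (szero : submod R^o) s) -> divisible submod_of s.
Proof.
move=> szs sm prim.
have szs' : size s == d by rewrite szs.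
have sopx := @sop_of_primary R m R_noeth R_local d (Tuple szs') R_dim sm prim.
suff gen (t p : seq R) : s = p ++ t -> divisible (killed_seq submod_of p) t.
  exact: (gen s [::]).
elim: t p => // a t IH p Es; split; last first.
  by rewrite -killed_seq_rcons; apply: IH; rewrite cat_rcons.
move=> v /killed_seqP[Ev pv].
have pd : (size p < d)%N by rewrite -szs Es size_cat /= addnS ltnS leq_addr.
have [|e' e'x e'E] := E_div sopx (i := Ordinal pd) (e := Submodule Ev).
  apply/forallP => j; apply/implyP => jp; apply/eqP; apply: val_inj => /=.
  apply: pv; rewrite (tnth_nth 0) /= Es nth_cat.
  by have jp' : (j < size p)%N := jp; rewrite jp' mem_nth.
exists (submodule_val e').
  apply/killed_seqP; split; first exact: submodule_valP.
  move=> y yp; have yi : (index y p < size p)%N by rewrite index_mem.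
  have /forallP/(_ (Ordinal (ltn_trans yi pd))) /= := e'x.
  rewrite yi /= => /eqP/(congr1 (@submodule_val _ _ _)) /=.
  by rewrite (tnth_nth 0) /= Es nth_cat yi nth_index.
move/(congr1 (@submodule_val _ _ _)): e'E => /=.
by rewrite (tnth_nth 0) /= Es nth_cat ltnn subnn.
Qed.

(** A nonzero element of a local domain is a unit or the first member of a system of parameters. *)
Lemma highly_divisible_mul (r : R) v : r != 0 -> submod_of v ->
  exists2 w, submod_of w & r *: w = v.
Proof.
move=> r0 Ev; have [mr|nmr] := boolP (r \in m); last first.
  have [|u ur] := M_unit (r := r); first exact/negP.
  by exists (u *: v); [apply: smemZ|rewrite scalerA mulrC ur scale1r].
have [s [szs sm prim]] := parameter_extends R_noeth M1 M_unit R_dim mr r0.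
by have [rE _] := highly_divisible_seq szs sm prim; apply: rE.
Qed.

Lemma top_local_cohomology_killed (s : seq R) : size s = d ->
  regular (szero : submod R^o) s -> (forall y, y \in s -> y \in m) ->
  (exists v, submod_of v /\ v <> 0) ->
  forall h : H, (forall y, y \in s -> y *: h = 0) -> submod_of h.
Proof.
move=> szs reg_s sm [v [Ev v0]].
have prim := regular_primary R_noeth M1 M_unit R_dim reg_s sm szs.
have [g [Jg genH]] := top_local_cohomology_cyclic I R_noeth R_local szs reg_s sm prim.
pose Hs := killed_seq (sfull : submod H) s; pose Es := killed_seq submod_of s.
pose J := sgen (szero : submod R^o) s.
have finJ : finlen (sfull : submod R^o) J.
  apply: (finlen_primary M_unit R_noeth (J := J)) => //.
    exact: noeth_sub (@sle0 _ _ _) R_noeth.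
  by move=> c a Jc _; apply: (@smemMr _ J (c : R) a).
have [_ maxJ] := @lenP _ _ (sfull : submod R^o) J (fun _ _ => Logic.I) finJ.
(* [Hs] is contained in the image of R under r |-> r g, and [J] kills [g], so chains in [Hs] pull
   back to chains in R / J. *)
have bndH n : chain n Hs szero -> (n <= len sfull J)%N.
  move=> cH; apply: maxJ.
  have HsP : Hs <=s push (orbit_map g) szero sfull.
    by move=> h /killed_seqP[_ /genH[r ->]]; apply: sle_addl; exists r.
  apply: chain_mono (chain_pull (@sle_refl _ _ _) HsP cH); first by [].
  by move=> c Jc; split=> //; apply: Jg.
have finH : finlen Hs szero by exists (len sfull J).
have EsHs : Es <=s Hs by move=> h /killed_seqP[_ sh]; apply/killed_seqP.
have finE : finlen Es szero := finlen_sub EsHs (@sle_refl _ _ _) finH.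
have [r [e0 me]] := socle_element R_noeth (local_cohomology_torsion v) v0.
set e := r *: v in e0 me; have Ee : submod_of e by apply: smemZ.
have [W [nWe maxW]] := maximal_avoiding e0.
pose T : lmodType R := quotient_module (submod_closed_of W).
pose p (h : H) : T := \pi_(Quotient.quot (submod_zmod (submod_closed_of W)))%qT h.
have pE h h' : p h = p h' <-> W (h - h').
  split=> [/eqP|Whh]; first by rewrite -Quotient.idealrBE => /submod_closed_ofP.
  by apply/eqP; rewrite -Quotient.idealrBE; apply/submod_closed_ofP.
have p_lin : linear p.
  move=> a h h'; rewrite /p raddfD; congr (_ + _); exact/esym/quotient_scaleE.
pose psi := HB.pack_for {linear H -> T} p (GRing.isLinear.Build R H T _ p p_lin).
(* If [h] is outside [W] and is sent into [W] by [m], maximality gives e = w + c h. Here [c] is a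
   unit, as otherwise [e] would lie in [W]. *)
have psi_soc (t : T) : (forall y : R, of_idealr m y -> y *: t = 0) ->
    exists c : R, t = c *: psi e.
  have [h <-] : exists h, p h = t by exists (repr t); apply: reprK.
  move=> mh; have {}mh y : y \in m -> W (y *: h).
    move=> /mh; rewrite -[p h]/(psi h) -linearZ -(linear0 psi) => /pE.
    by rewrite subr0.
  have [Wh|nWh] := pselect (W h).
    exists 0; rewrite scale0r -[p h]/(psi h) -(linear0 psi); apply/pE.
    by rewrite subr0.
  have : sadd W (scyc h) e.
    apply: contrapT => ne; apply: nWh; apply: (maxW _ _ ne); first exact: sle_addl.
    by apply: sle_addr; apply: scyc_id.
  case=> w [_ [Ww [c _ ->] Ew]].
  have [|u uc] := M_unit (r := c).
    by move=> mc; apply: nWe; rewrite Ew; apply: smemD => //; apply: mh.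
  exists u; rewrite -linearZ; apply/pE; rewrite Ew orbit_mapE scalerDr scalerA uc scale1r.
  by rewrite opprD addrC subrK; apply/smemN/smemZ.
have le_len : (len (sfull : submod R^o) J <= len Es szero)%N.
  apply: (len_regular_le M1 M_unit R_noeth (complete_series R_complete)
    (t0 := psi e) _ psi_soc (psi := psi)) => //.
  - by move=> y /me ye; rewrite -linearZ ye linear0.
  - exact: highly_divisible_seq.
  - move=> y /sm my; split=> // u _.
    exact: tors_power_torsion my _ (local_cohomology_torsion u).
  (* For nonzero [a] write e = a w with w in E; the map r |-> r psi does not kill [a] because [e] is
     not in [W]. *)
  - move=> a ra; apply: contrapT => /eqP a0.
    have [w Ew awe] := highly_divisible_mul a0 Ee.
    apply: nWe; have := ra w Ew; rewrite awe -(linear0 psi) => /pE.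
    by rewrite subr0.
(* If the inclusion were strict, [Hs] would have a chain one longer than the length of [Es], which
   already reaches that of R / J. *)
have EH : Es = Hs.
  apply: contrapT => nEH.
  have [cE _] := lenP (@sle0 _ _ Es) finE.
  have : (len Es szero < len sfull J)%N by apply: bndH; exists Es.
  by rewrite ltnNge le_len.
move=> h sh; have : Hs h by apply/killed_seqP.
by rewrite -EH => /killed_seqP[].
Qed.

End TopLocalCohomology.

Theorem corollary1p7 (R : idomainType) (m : idealr R) (d : nat)
    (R_noetherian : noetherian R) (R_local : local_ring m)
    (R_dim : krull_dim R d) (R_complete : adically_complete m)
    (R_CM : cohen_macaulay m)
    (I : injective_resolution R^o) (E : submodClosed (local_cohomology m I d)) :
  highly_divisible m d (submodule E) -> E =i pred1 0 \/ E =i predT.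
Proof.
move=> E_div.
have [[v [Ev v0]]|nE] := pselect (exists v, v \in E /\ v <> 0); last first.
  left=> v; rewrite inE; apply/idP/eqP => [Ev|->]; last exact: rpred0.
  by apply: contrapT => v0; apply: nE; exists v.
right=> h; rewrite [RHS]inE.
have [n R_dimn [[s [szs sm /regular_sequence_regular reg_s]] _]] := R_CM.
have Edn : n = d.
  apply/eqP; rewrite eqn_leq; apply/andP; split.
    by have [[P cP] _] := R_dimn; apply: R_dim.2 cP.
  by have [[P cP] _] := R_dim; apply: R_dimn.2 cP.
have [k kh] := local_cohomology_torsion h.
have R_noeth := noetherian_noeth R_noetherian.
(* As m^k kills [h], so do the (k+1)-st powers of the regular sequence; the exponent is positive, so
   these stay in [m] even when [k] is 0. *)
apply: (top_local_cohomology_killed R_noetherian R_local R_dim R_complete E_div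
  (s := [seq x ^+ k.+1 | x <- s])).
- by rewrite size_map szs.
- exact: (regular_powers R_noeth (@of_idealr1 R m) (of_idealr_unit R_noeth R_local)).
- by move=> _ /mapP[x /sm mx ->]; rewrite exprS; apply: (@smemMr _ (of_idealr m) x).
- by exists v.
- move=> _ /mapP[x /sm mx ->]; rewrite exprS -scalerA kh ?scaler0 //.
  exact: ideal_expX.
Qed.
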